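(* Let $F:\mathcal{S}_n\to\mathbb{R}$ be quasiconcave, uniformly elliptic, of class $C^1$, with $F(0)=0$. Let $u\in C^3(\overline{B}_1)$ satisfy $F(D^2u)=0$ in $B_1\subset\mathbb{R}^n$. Then \[ \sup_{B_{1/2}}|Du|\leq C\,\mathrm{osc}_{B_1}u. \] If in addition $F\in C^2$ and $u\in C^4$, then \[ \sup_{B_{1/2}}|D^2u|\leq C\,\mathrm{osc}_{B_1}u. \] Here $C$ depends only on $n,\lambda,\Lambda$.
   Context: $\mathcal{S}_n$ is the space of real symmetric $n\times n$ matrices. $F$ is uniformly elliptic with constants $0<\lambda\le\Lambda$ if $\lambda\|N\|\leq F(M+N)-F(M)\leq\Lambda\|N\|$ for all $M,N\in\mathcal{S}_n$ with $N\geq0$, where $\|N\|=\sup_{|x|=1}|Nx|$. $F$ is quasiconcave if $F(\theta M_1+(1-\theta)M_2)\geq\min\{F(M_1),F(M_2)\}$ for all $M_1,M_2\in\mathcal{S}_n$, $\theta\in[0,1]$. $\mathrm{osc}_{B_1}u=\sup_{B_1}u-\inf_{B_1}u$. *)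

(* Defs.v *)
From HB Require Import structures.
From mathcomp Require Import all_boot all_order all_algebra.
From mathcomp Require Import all_classical all_reals all_analysis.
Set Implicit Arguments. Unset Strict Implicit. Unset Printing Implicit Defensive.
Import Order.TTheory GRing.Theory Num.Theory.
Import numFieldNormedType.Exports.
Local Open Scope classical_set_scope.
Local Open Scope ring_scope.

Definition fnorm (R : realType) (m k : nat) (A : 'M[R]_(m, k)) : R :=
  Num.sqrt (\sum_i \sum_j A i j ^+ 2).

Definition eball (R : realType) (n : nat) (c : 'rV[R]_n) (r : R) : set 'rV[R]_n :=
  [set x | fnorm (x - c) < r].
Definition ecball (R : realType) (n : nat) (c : 'rV[R]_n) (r : R) : set 'rV[R]_n :=
  [set x | fnorm (x - c) <= r].

Definition opnorm (R : realType) (n : nat) (N : 'M[R]_n) : R :=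
  sup [set fnorm (N *m x) | x in [set x : 'cV[R]_n | fnorm x = 1]].

Definition symmetric (R : realType) (n : nat) (M : 'M[R]_n) : Prop := M^T = M.

Definition psd (R : realType) (n : nat) (N : 'M[R]_n) : Prop :=
  symmetric N /\ forall x : 'cV[R]_n, 0 <= (x^T *m N *m x) 0 0.

Definition uniformly_elliptic (R : realType) (n : nat) (F : 'M[R]_n -> R)
    (lam Lam : R) : Prop :=
  forall M N : 'M[R]_n, symmetric M -> psd N ->
    lam * opnorm N <= F (M + N) - F M <= Lam * opnorm N.

Definition quasiconcave (R : realType) (n : nat) (F : 'M[R]_n -> R) : Prop :=
  forall (M1 M2 : 'M[R]_n) (t : R), symmetric M1 -> symmetric M2 ->
    0 <= t <= 1 -> Num.min (F M1) (F M2) <= F (t *: M1 + (1 - t) *: M2).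

Definition Sym (R : realType) (n : nat) : set 'M[R]_n := [set M | symmetric M].

Definition C1_sym (R : realType) (n : nat) (F : 'M[R]_n -> R) : Prop :=
  forall N : 'M[R]_n, symmetric N ->
    (forall M, symmetric M -> derivable F M N) /\
    {within @Sym R n, continuous ('D_N F)}.

Definition C2_sym (R : realType) (n : nat) (F : 'M[R]_n -> R) : Prop :=
  C1_sym F /\
  forall N1 N2 : 'M[R]_n, symmetric N1 -> symmetric N2 ->
    (forall M, symmetric M -> derivable ('D_N2 F) M N1) /\
    {within @Sym R n, continuous ('D_N1 ('D_N2 F))}.

Definition evec (R : realType) (n : nat) (i : 'I_n) : 'rV[R]_n := delta_mx 0 i.

Definition dpart (R : realType) (n : nat) (s : seq 'I_n) (u : 'rV[R]_n -> R)
  : 'rV[R]_n -> R :=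
  foldr (fun i g => 'D_(@evec R n i) g) u s.

Definition Ck_cball (R : realType) (n k : nat) (c : 'rV[R]_n) (r : R)
    (u : 'rV[R]_n -> R) : Prop :=
  (forall s : seq 'I_n, (size s < k)%N -> forall i x, eball c r x ->
      derivable (dpart s u) x (@evec R n i)) /\
  (forall s : seq 'I_n, (size s <= k)%N ->
      exists g : 'rV[R]_n -> R, {within ecball c r, continuous g} /\
        forall x, eball c r x -> g x = dpart s u x).

Definition grad (R : realType) (n : nat) (u : 'rV[R]_n -> R) (x : 'rV[R]_n)
  : 'rV[R]_n := \row_i 'D_(@evec R n i) u x.

Definition hessian (R : realType) (n : nat) (u : 'rV[R]_n -> R) (x : 'rV[R]_n)
  : 'M[R]_n := \matrix_(i, j) 'D_(@evec R n i) ('D_(@evec R n j) u) x.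

Definition osc (R : realType) (n : nat) (u : 'rV[R]_n -> R) (A : set 'rV[R]_n) : R :=
  sup (u @` A) - inf (u @` A).

(* Main.v *)
Require Import Defs.
From HB Require Import structures.
From mathcomp Require Import all_boot all_order all_algebra.
From mathcomp Require Import all_classical all_reals all_analysis.
From mathcomp Require Import ring lra.
Import Order.TTheory GRing.Theory Num.Theory.
Import numFieldNormedType.Exports.
Local Open Scope classical_set_scope.
Local Open Scope ring_scope.
Set Implicit Arguments. Unset Strict Implicit. Unset Printing Implicit Defensive.

(* Bernstein's method.  At [x], let [A] be the gradient of [F] at [D^2 u x].
   Quasiconcavity makes [A] a supporting functional of the convex set
   [{F >= 0}], on whose boundary [D^2 u] takes its values; hence for every [e]
   the function [t |-> <A, D^2 u (x + t e)>] is minimal at [0].  Its first two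
   derivatives give [<A, D^2 u_e> = 0] and [<A, D^2 u_ee> >= 0], and comparing
   with the zero matrix gives [<A, D^2 u> <= 0].  The maximum principle, applied to
   [(rho^2 - |x|^2)^2 g^2 + gam v^2] with [gam = 15 Lam / lam], then bounds
   [g = u_e] through [v = u - sup u], and afterwards the positive part of
   [g = u_ee] through [v = u_e].  An upper bound for all [u_ee] bounds
   [D^2 u] by ellipticity. *)

(** The auxiliary term works because, with [L] the pairing of [A] with the Hessian,
    [L (v^2) = 2 <A, Dv^T Dv> + 2 v L v]. Each time [g] is a component of [Dv], so ellipticity
    bounds the first term below by [2 lam g^2], enough to absorb what the cutoff costs. The second
    term must not be negative: for the gradient, [v = u - sup u] is nonpositive to match [L u <= 0];
    for second derivatives, [L u_e = 0]. The functional [A] is frozen at the point of maximum, and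
    nothing relates its values at different points, which an argument at a single point tolerates.
    As [u_ee] satisfies only [L u_ee >= 0], just an upper bound comes out for it, and the lower one
    has to come from the equation itself. Derivatives are directional throughout, and those of [F]
    are given only at and along symmetric matrices; hence the preliminary work on linearity in the
    direction. *)

(** * Directional derivatives: linearity in the direction, symmetry of mixed derivatives *)

Section Directional.
Variables (R : realType) (V : normedModType R).
Implicit Types (f : V -> R) (x y a b : V).

Lemma is_derive_line f y b (t : R) : derivable f (y + t *: b) b ->
  is_derive t 1 (fun s : R => f (y + s *: b)) ('D_b f (y + t *: b)).
Proof.
move=> df.
have E : (fun h : R => h^-1 *:
      (((fun s : R => f (y + s *: b)) \o shift t) (h *: (1 : R)) - f (y + t *: b)))
    = (fun h : R => h^-1 *:
      ((f \o shift (y + t *: b)) (h *: b) - f (y + t *: b))).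
  apply/funext => h /=; congr (_ *: (f _ - _)).
  by rewrite [_%:A]mulr1 scalerDl addrCA.
by split; rewrite /derivable /derive E.
Qed.

Lemma cvg_is_derive f x b (d : R) :
  (fun h : R => h^-1 * (f (x + h *: b) - f x)) @ 0^' --> d -> is_derive x b f d.
Proof.
have -> : (fun h : R => h^-1 * (f (x + h *: b) - f x)) =
    (fun h : R => h^-1 *: ((f \o shift x) (h *: b) - f x)).
  by apply/funext => h /=; rewrite [x + _]addrC.
by move=> H; split; [apply/cvg_ex; exists d|exact: (cvg_lim _ H)].
Qed.

Lemma is_derive_cvg f x b (d : R) : is_derive x b f d ->
  (fun h : R => h^-1 * (f (x + h *: b) - f x)) @ 0^' --> d.
Proof.
move=> [df <-].
have -> : (fun h : R => h^-1 * (f (x + h *: b) - f x)) =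
    (fun h : R => h^-1 *: ((f \o shift x) (h *: b) - f x)).
  by apply/funext => h /=; rewrite [x + _]addrC.
exact: df.
Qed.

Lemma is_derive_dirZ f x b (c : R) : derivable f x b ->
  is_derive x (c *: b) f (c * 'D_b f x).
Proof.
move=> df.
have [->|c0] := eqVneq c 0; first by rewrite scale0r mul0r; exact: is_derive0.
apply: cvg_is_derive.
have -> : (fun h : R => h^-1 * (f (x + h *: (c *: b)) - f x)) =
    (fun h : R => c * ((fun k : R => k^-1 * (f (x + k *: b) - f x)) (h * c))).
  apply/funext => h /=; rewrite scalerA invfM !mulrA.
  by congr (_ * _); rewrite -mulrA mulrCA mulfV// mulr1.
apply: cvgMr.
apply: (@cvg_comp _ _ _ (fun h : R => h * c)
  (fun k : R => k^-1 * (f (x + k *: b) - f x)) _ (0^') _ _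
  (is_derive_cvg (derivableP df))).
move=> A [e /= e0 eA]; exists (e / `|c|) => /=; first by rewrite divr_gt0 ?normr_gt0.
move=> h /=; rewrite !sub0r !normrN => he h0; apply: eA => /=.
  by rewrite sub0r normrN normrM -ltr_pdivlMr ?normr_gt0.
by rewrite mulf_neq0.
Qed.

Lemma MVT01 (phi dphi : R -> R) :
  (forall s : R, 0 <= s <= 1 -> is_derive s 1 phi (dphi s)) ->
  exists2 s : R, 0 <= s <= 1 & phi 1 - phi 0 = dphi s.
Proof.
move=> dphiP.
have [|| s] := @MVT R phi dphi 0 1 ltr01.
- by move=> s; rewrite in_itv/= => /andP[/ltW s0 /ltW s1]; apply: dphiP; rewrite s0.
- apply: derivable_within_continuous => s; rewrite in_itv/= => s01.
  by case: (dphiP s s01).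
rewrite in_itv/= subr0 mulr1 => /andP[/ltW s0 /ltW s1] E.
by exists s => //; rewrite s0.
Qed.

Lemma MVT_line f y b (t : R) :
  (forall s : R, 0 <= s <= 1 -> derivable f (y + t *: (s *: b)) b) ->
  exists2 s : R, 0 <= s <= 1 & f (y + t *: b) - f y = t * 'D_b f (y + t *: (s *: b)).
Proof.
move=> df.
have [|s s01 E] := @MVT01 (fun s => f (y + s *: (t *: b)))
    (fun s => t * 'D_b f (y + t *: (s *: b))).
  move=> s s01; have := is_derive_dirZ t (df s s01).
  rewrite !scalerA [t * s]mulrC -scalerA => -[d1 <-].
  exact: is_derive_line.
by exists s => //; rewrite -E scale1r scale0r addr0.
Qed.

(** The mean value theorem yields points that depend on [t] in an uncontrolled way. Uniformity in
    [r] and [s] over the whole small parallelogram makes their position irrelevant. *)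
Lemma near_line2 x a b (P : set V) : (\forall y \near x, P y) ->
  \forall t \near (0 : R), forall r s : R, 0 <= r <= 1 -> 0 <= s <= 1 ->
    P (x + t *: (r *: a + s *: b)).
Proof.
move=> /nbhs_normP[e /= e0 eP].
have n0 : 0 < `|a| + `|b| + 1 by apply: ltr_wpDl.
exists (e / (`|a| + `|b| + 1)) => /=; first by rewrite divr_gt0.
move=> t /=; rewrite sub0r normrN ltr_pdivlMr// => te r s /andP[r0 r1] /andP[s0 s1].
apply: eP => /=; rewrite opprD addNKr normrN normrZ; apply: le_lt_trans te.
apply: ler_wpM2l => //; apply: le_trans (ler_normD _ _) _.
rewrite !normrZ (ger0_norm r0) (ger0_norm s0).
have := ler_piMl (normr_ge0 a) r1; have := ler_piMl (normr_ge0 b) s1; lra.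
Qed.

(* [U] need not be open: for the operator [F] it is the space of symmetric
   matrices, outside of which nothing is known. *)
Lemma is_derive_dirD (U : set V) f x a b :
  (\forall t \near (0 : R), forall s : R, 0 <= s <= 1 -> U (x + t *: (a + s *: b))) ->
  (forall y, U y -> derivable f y b) ->
  'D_b f @ within U (nbhs x) --> 'D_b f x ->
  derivable f x a -> is_derive x (a + b) f ('D_a f x + 'D_b f x).
Proof.
move=> nU db cb da; apply: cvg_is_derive.
(* The increment is split into a move along [a] from [x], then one along [b]. The first quotient
   involves only the derivative at [x]; the second is a value of ['D_b f] at a nearby point, by the
   mean value theorem. *)
have -> : (fun h : R => h^-1 * (f (x + h *: (a + b)) - f x)) =
   (fun h : R => h^-1 * (f (x + h *: a) - f x) +
                 h^-1 * (f (x + h *: a + h *: b) - f (x + h *: a))).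
  by apply/funext => h; rewrite -mulrDr scalerDr addrA; congr (_ * _); ring.
apply: cvgD; first exact: is_derive_cvg (derivableP da).
apply/cvgrPdist_lt => e e0.
move/cvgrPdist_lt : cb => /(_ e e0); rewrite near_withinE => /(near_line2 a b) cb.
near=> h.
have h0 : h != 0 by near: h; exact: nbhs_dnbhs_neq.
have Uh s : 0 <= s <= 1 -> U (x + h *: a + h *: (s *: b)).
  move=> s01; rewrite -addrA -scalerDr; move: s s01; near: h.
  exact: nbhs_dnbhs.
have [|s s01 ->] := @MVT_line f (x + h *: a) b h.
  by move=> s s01; apply: db; exact: Uh.
rewrite mulKf//.
have := Uh s s01; rewrite -addrA -scalerDr.
have : forall s : R, 0 <= s <= 1 -> U (x + h *: (a + s *: b)) ->
    `|'D_b f x - 'D_b f (x + h *: (a + s *: b))| < e.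
  near: h; apply: nbhs_dnbhs; near=> h => r r01.
  rewrite -[a in (x + _ *: (a + _))]scale1r.
  have ab := near cb h.
  by apply: ab => //; rewrite ?ler01 ?lexx.
by apply.
Unshelve. all: by end_near. Qed.

Definition mixed_difference f x a b (t : R) : R :=
  f (x + t *: a + t *: b) - f (x + t *: a) - f (x + t *: b) + f x.

Lemma mixed_differenceC f x a b t :
  mixed_difference f x a b t = mixed_difference f x b a t.
Proof. by rewrite /mixed_difference [_ + _ *: b]addrAC; ring. Qed.

(** Two mean value theorems: along [a] for the difference of [f] on two parallel segments, then
    along [b] for ['D_a f]. The quotient is thus a value of the iterated derivative inside the
    parallelogram, and continuity at [x] concludes. *)
Lemma cvg_mixed_difference (U : set V) f x a b : open U -> U x ->
  (forall y, U y -> derivable f y a) ->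
  (forall y, U y -> derivable ('D_a f) y b) ->
  {for x, continuous ('D_b ('D_a f))} ->
  (fun t => mixed_difference f x a b t / t ^+ 2) @ 0^' --> 'D_b ('D_a f) x.
Proof.
move=> oU Ux da dab cab.
have nU := near_line2 a b (open_nbhs_nbhs (conj oU Ux)).
apply/cvgrPdist_lt => e e0.
move/cvgrPdist_lt : cab => /(_ e e0) /(near_line2 a b) cab.
near=> t.
have t0 : t != 0 by near: t; exact: nbhs_dnbhs_neq.
have Ut r s : 0 <= r <= 1 -> 0 <= s <= 1 -> U (x + t *: (r *: a) + t *: (s *: b)).
  by rewrite -addrA -scalerDr; move: r s; near: t; exact: nbhs_dnbhs.
have I1 : 0 <= (1 : R) <= 1 by rewrite ler01 lexx.
have I0 : 0 <= (0 : R) <= 1 by rewrite ler01 lexx.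
have [|r r01 E] := @MVT01 (fun r => f (x + t *: b + r *: (t *: a)) - f (x + r *: (t *: a)))
   (fun r => t * 'D_a f (x + t *: b + t *: (r *: a)) - t * 'D_a f (x + t *: (r *: a))).
  move=> r r01; apply: is_deriveB.
    have /(is_derive_dirZ t) : derivable f (x + t *: b + t *: (r *: a)) a.
      by apply: da; have := Ut r 1 r01 I1; rewrite scale1r addrAC.
    by rewrite !scalerA [t * r]mulrC -scalerA => -[d1 <-]; exact: is_derive_line.
  have /(is_derive_dirZ t) : derivable f (x + t *: (r *: a)) a.
    by apply: da; have := Ut r 0 r01 I0; rewrite scale0r scaler0 addr0.
  by rewrite !scalerA [t * r]mulrC -scalerA => -[d1 <-]; exact: is_derive_line.
have [|s s01 E'] := @MVT_line ('D_a f) (x + t *: (r *: a)) b t.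
  by move=> s s01; apply: dab; exact: Ut.
have -> : mixed_difference f x a b t =
    t * (t * 'D_b ('D_a f) (x + t *: (r *: a) + t *: (s *: b))).
  rewrite -E' mulrBr [x + _ *: (r *: a) + _]addrAC -E !scale1r !scale0r !addr0.
  by rewrite /mixed_difference [_ + _ *: b]addrAC; ring.
rewrite mulrA -expr2 mulrAC mulfV ?expf_neq0// mul1r -addrA -scalerDr.
by move: r s r01 s01 {E E'}; near: t; exact: nbhs_dnbhs.
Unshelve. all: by end_near. Qed.

(** Schwarz's theorem: the mixed difference is symmetric in [a] and [b], so both iterated
    derivatives are limits of the same quotient. *)
Lemma derive_mixedC (U : set V) f x a b : open U -> U x ->
  (forall y, U y -> derivable f y a) -> (forall y, U y -> derivable f y b) ->
  (forall y, U y -> derivable ('D_a f) y b) ->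
  (forall y, U y -> derivable ('D_b f) y a) ->
  {for x, continuous ('D_b ('D_a f))} -> {for x, continuous ('D_a ('D_b f))} ->
  'D_b ('D_a f) x = 'D_a ('D_b f) x.
Proof.
move=> oU Ux da db dab dba cab cba.
have h1 := cvg_mixed_difference oU Ux da dab cab.
have h2 := cvg_mixed_difference oU Ux db dba cba.
have E : mixed_difference f x a b = mixed_difference f x b a.
  by apply/funext => t; rewrite mixed_differenceC.
apply: (cvg_unique _ h1); first exact: norm_hausdorff.
by rewrite E.
Qed.

End Directional.

(** * Derivative bounds from one-sided difference quotients *)

Section OneSided.
Variables (R : realType) (V : normedModType R).

Lemma near0_pos (P : set R) : (\forall t \near 0^', P t) ->
  exists2 t : R, 0 < t <= 1 & P t.
Proof.
move=> [d /= d0 dP]; exists (Num.min (d / 2) 1).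
  by rewrite lt_min ge_min lexx orbT ltr01 divr_gt0.
have m0 : 0 < Num.min (d / 2) 1 by rewrite lt_min ltr01 divr_gt0.
apply: dP => /=; last exact: lt0r_neq0.
by rewrite sub0r normrN gtr0_norm// gt_min ltr_pdivrMr// ltr_pMr// ltr1n.
Qed.

(** Ellipticity and quasiconcavity control increments only for positive [t], the latter only up to
    [t = 1]. Since the two-sided limit exists, it can be read off from such [t] alone. *)
Lemma derive_ge (f : V -> R) x v c : derivable f x v ->
  (forall t : R, 0 < t <= 1 -> c * t <= f (x + t *: v) - f x) -> c <= 'D_v f x.
Proof.
move=> /derivableP/is_derive_cvg df H; rewrite leNgt; apply/negP => lt_c.
have [t t01] := near0_pos (cvgr_lt _ df _ lt_c).
have /andP[t0 _] := t01.
by rewrite ltNge mulrC ler_pdivlMr// H.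
Qed.

Lemma derive_le (f : V -> R) x v c : derivable f x v ->
  (forall t : R, 0 < t <= 1 -> f (x + t *: v) - f x <= c * t) -> 'D_v f x <= c.
Proof.
move=> /derivableP/is_derive_cvg df H; rewrite leNgt; apply/negP => lt_c.
have [t t01] := near0_pos (cvgr_gt _ df _ lt_c).
have /andP[t0 _] := t01.
by rewrite ltNge mulrC ler_pdivrMr// H.
Qed.

End OneSided.

(** * Expansions with Peano remainder on a line, and tests for extrema *)

Section Jets.
Variable R : realType.
Implicit Types (f g e : R -> R) (a b c : R).

(* For [k = 1] the coefficient [c] is not determined by [f]. *)
Definition jet (k : nat) f a b c :=
  exists2 e, e t @[t --> (0 : R)] --> (0 : R) &
    forall t, f t = a + b * t + c * t ^+ 2 + e t * t ^+ k.

Lemma cvg_exprn0 (j : nat) : (0 < j)%N -> (t ^+ j) @[t --> (0 : R)] --> (0 : R).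
Proof.
move=> j0; have := @exprn_continuous R j 0.
by rewrite /continuous_at expr0n gtn_eqF.
Qed.

Lemma jet_cvg k f a b c : (0 < k)%N -> jet k f a b c -> f t @[t --> (0 : R)] --> a.
Proof.
move=> k0 [e e0 fE].
have -> : f = (fun t => a + b * t + c * t ^+ 2 + e t * t ^+ k) by apply/funext.
rewrite -[X in _ --> X](_ : a + b * 0 + c * 0 + 0 * 0 = a); last by ring.
apply: cvgD; last by apply: cvgM => //; exact: cvg_exprn0.
apply: cvgD; last by apply: cvgMr; exact: cvg_exprn0.
by apply: cvgD; [exact: cvg_cst|apply: cvgMr; exact: cvg_id].
Qed.

Lemma jet_cst k a : jet k (fun=> a) a 0 0.
Proof. by exists (fun=> 0) => [|t]; [exact: cvg_cst|ring]. Qed.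

Lemma jetD k f g a b c a' b' c' : jet k f a b c -> jet k g a' b' c' ->
  jet k (fun t => f t + g t) (a + a') (b + b') (c + c').
Proof.
move=> [e e0 fE] [e' e'0 gE]; exists (fun t => e t + e' t).
  by rewrite -[X in _ --> X]addr0; exact: cvgD.
by move=> t; rewrite fE gE; ring.
Qed.

Lemma jetZ k f a b c r : jet k f a b c ->
  jet k (fun t => r * f t) (r * a) (r * b) (r * c).
Proof.
move=> [e e0 fE]; exists (fun t => r * e t).
  by rewrite -[X in _ --> X](mulr0 r); exact: cvgMr.
by move=> t; rewrite fE; ring.
Qed.

Lemma jet_sum k (n : nat) (f : 'I_n -> R -> R) (a b c : 'I_n -> R) :
  (forall i, jet k (f i) (a i) (b i) (c i)) ->
  jet k (fun t => \sum_i f i t) (\sum_i a i) (\sum_i b i) (\sum_i c i).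
Proof.
move=> H; elim: (index_enum _) => [|i r IH].
  by under eq_fun do rewrite big_nil; rewrite !big_nil; exact: jet_cst.
by under eq_fun do rewrite big_cons; rewrite !big_cons; exact: jetD.
Qed.

Lemma jetM f g a b c a' b' c' : jet 2 f a b c -> jet 2 g a' b' c' ->
  jet 2 (fun t => f t * g t) (a * a') (a * b' + b * a') (a * c' + b * b' + c * a').
Proof.
move=> jf jg; have cg := jet_cvg (ltn0Sn 1) jg.
move: jf jg => [e e0 fE] [e' e'0 gE].
(* The last two terms are the cubic and quartic products of the coefficients, divided by [t ^+ 2].
   Leaving [g] unexpanded next to [e] avoids products of remainders. *)
exists (fun t => e t * g t + (a + b * t + c * t ^+ 2) * e' t
         + t * (b * c' + c * b') + t ^+ 2 * (c * c')).
  have t2 := @cvg_exprn0 2 isT.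
  rewrite -[X in _ --> X](_ : 0 * a' + (a + b * 0 + c * 0) * 0
            + 0 * (b * c' + c * b') + 0 * (c * c') = 0); last by ring.
  apply: cvgD; last by apply: cvgMl.
  apply: cvgD; last by apply: cvgMl; exact: cvg_id.
  apply: cvgD; first exact: cvgM.
  apply: cvgM => //; apply: cvgD; last by apply: cvgMr.
  by apply: cvgD; [exact: cvg_cst|apply: cvgMr; exact: cvg_id].
by move=> t; rewrite mulrDl !fE !gE; ring.
Qed.

Lemma cvg0_dnbhs e : e 0 = 0 -> e t @[t --> 0^'] --> (0 : R) ->
  e t @[t --> (0 : R)] --> (0 : R).
Proof.
move=> e00 /cvgrPdist_lt ce; apply/cvgrPdist_lt => d d0.
have := ce d d0; rewrite near_withinE; apply: filterS => t.
by have [->|t0] := eqVneq t 0; [rewrite e00 subrr normr0|exact].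
Qed.

Lemma is_derive_jet1 f d : is_derive (0 : R) 1 f d -> jet 1 f (f 0) d 0.
Proof.
move=> /is_derive_cvg; under eq_fun do rewrite add0r [_%:A]mulr1.
move=> /cvgrPdist_lt df.
(* A jet asks for a limit along full neighbourhoods of 0, so the remainder has to be given the value
   0 at 0. *)
exists (fun t => if t == 0 then 0 else t^-1 * (f t - f 0) - d).
  apply: cvg0_dnbhs; first by rewrite eqxx.
  apply/cvgrPdist_lt => r r0.
  have := df _ r0; rewrite !near_withinE; apply: filterS => t H t0.
  by rewrite (negbTE t0) sub0r normrN distrC; exact: H.
move=> t; have [->|t0] := eqVneq t 0; first by ring.
by field.
Qed.

(** An expansion of the derivative is integrated by the mean value theorem, so that [f'] need not be
    integrable, nor continuous away from 0. *)
Lemma jet1_jet2 f f' b c : (\forall t \near (0 : R), is_derive (t : R) 1 f (f' t)) ->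
  jet 1 f' b c 0 -> jet 2 f (f 0) b (c / 2).
Proof.
move=> df [e e0 f'E].
exists (fun t => if t == 0 then 0
   else (f t - (f 0 + b * t + c / 2 * t ^+ 2)) / t ^+ 2); last first.
  move=> t; have [->|t0] := eqVneq t 0; first by ring.
  by field.
apply: cvg0_dnbhs; first by rewrite eqxx.
apply/cvgrPdist_lt => r r0.
(* On the real line, the choice [0] and [1] of directions gives the property on the whole segment
   from 0 to [t], where the mean value point lies. *)
move/cvgrPdist_lt : e0 => /(_ r r0) /(near_line2 (0 : R) 1) ne.
move: df => /(near_line2 (0 : R) 1) ndf.
near=> t.
have t0 : t != 0 by near: t; exact: nbhs_dnbhs_neq.
rewrite (negbTE t0).
have I0 : 0 <= (0 : R) <= 1 by rewrite ler01 lexx.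
have dft (s : R) : 0 <= s <= 1 -> is_derive (s * t) 1 f (f' (s * t)).
  move=> s01.
  have H : forall s r : R, 0 <= r <= 1 -> 0 <= s <= 1 ->
       is_derive (0 + t *: (r *: (0:R) + s *: 1)) 1 f (f' (0 + t *: (r *: (0:R) + s *: 1))).
    by near: t; apply: nbhs_dnbhs; near=> t => s' r' H1 H2; apply: (near ndf t).
  by have := H s 0 I0 s01; rewrite scale0r !add0r [_%:A]mulr1 [_ *: _]mulrC.
have et (s : R) : 0 <= s <= 1 -> `|e (s * t)| < r.
  move=> s01.
  have H : forall s r' : R, 0 <= r' <= 1 -> 0 <= s <= 1 ->
       `|0 - e (0 + t *: (r' *: (0:R) + s *: 1))| < r.
    by near: t; apply: nbhs_dnbhs; near=> t => s' r' H1 H2; apply: (near ne t).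
  have := H s 0 I0 s01.
  by rewrite scale0r !add0r [_%:A]mulr1 [_ *: _]mulrC normrN.
(* After subtraction of the candidate polynomial, the derivative in [s] is
   [t (f' (s t) - b - c s t) = t^2 s e (s t)]. *)
have [|s s01 E] := @MVT01 R (fun s => f (s * t) - (b * t * s + c / 2 * t ^+ 2 * s ^+ 2))
   (fun s => t * f' (s * t) - (b * t + c * t ^+ 2 * s)).
  move=> s s01; apply: is_deriveB.
    have [d1 d2] := dft s s01.
    have E1 : (0 + s *: t) = s * t by rewrite add0r.
    have : derivable f (0 + s *: t) 1 by rewrite E1.
    move=> /(is_derive_dirZ t)[d3 d4].
    have := @is_derive_line R R f 0 t s; rewrite [t%:A]mulr1 in d3 d4.
    move=> /(_ d3); rewrite d4 E1 d2.
    by under eq_fun do rewrite add0r.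
  apply: is_derive_eq.
  rewrite /GRing.scale/= ?expr1 ?mulr1 ?mulr0 ?addr0.
  by field.
move: E; rewrite mul1r mul0r f'E.
have := et s s01; set q := e _ => qr E.
have -> : f t - (f 0 + b * t + c / 2 * t ^+ 2) = t ^+ 2 * (s * q).
  transitivity (f t - (b * t * 1 + c / 2 * t ^+ 2 * 1 ^+ 2)
     - (f 0 - (b * t * 0 + c / 2 * t ^+ 2 * 0 ^+ 2))); first by ring.
  by rewrite E; ring.
rewrite mulrAC mulfV ?expf_neq0// mul1r sub0r normrN normrM.
have /andP[s0 s1] := s01.
by rewrite (ger0_norm s0); apply: le_lt_trans qr; exact: ler_piMl.
Unshelve. all: by end_near. Qed.

Lemma jet1_min_eq0 f a b c : jet 1 f a b c -> (\forall t \near (0 : R), a <= f t) -> b = 0.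
Proof.
move=> [e e0 fE] mf; apply/eqP; apply/negPn/negP => b0.
have nb : 0 < `|b| by rewrite normr_gt0.
have : (c * t + e t) @[t --> (0 : R)] --> (0 : R).
  rewrite -[X in _ --> X](_ : c * 0 + 0 = 0); last by ring.
  by apply: cvgD => //; apply: cvgMr; exact: cvg_id.
move/cvgrPdist_lt => /(_ _ nb) ne.
have [d /= d0 dP] : nbhs 0 [set t | a <= f t /\ `|0 - (c * t + e t)| < `|b|] by apply: filterI.
have P t : `|t| < d -> 0 <= t * (b + (c * t + e t)) /\ `|c * t + e t| < `|b|.
  move=> td; have [] := dP t; first by rewrite /= sub0r normrN.
  rewrite sub0r normrN fE => h1 h2; split => //.
  by move: h1; rewrite -!addrA lerDl; congr (_ <= _); ring.
have d2 : 0 < d / 2 by rewrite divr_gt0.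
have d2d : d / 2 < d by rewrite ltr_pdivrMr// ltr_pMr// ltr1n.
have [] := P (d / 2); first by rewrite gtr0_norm.
have [] := P (- (d / 2)); first by rewrite normrN gtr0_norm.
rewrite mulNr oppr_ge0 pmulr_rle0// pmulr_rge0//.
set q := _ + e _; set q' := _ + e _ => h1 h2 h3 h4.
case: (ltgtP b 0) b0 h2 h4 => // b0 _; rewrite ?(ltr0_norm b0) ?(gtr0_norm b0) !ltr_norml; lra.
Qed.

Lemma jet2_max_le0 f a b c : jet 2 f a b c -> (\forall t \near (0 : R), f t <= a) -> c <= 0.
Proof.
move=> [e e0 fE] mf; rewrite leNgt; apply/negP => c0.
move/cvgrPdist_lt : e0 => /(_ _ c0) ne.
have [d /= d0 dP] : nbhs 0 [set t | f t <= a /\ `|0 - e t| < c] by apply: filterI.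
have P t : `|t| < d -> f t <= a /\ `|e t| < c.
  by move=> td; have := dP t; rewrite /= !sub0r !normrN; exact.
have d2 : 0 < d / 2 by rewrite divr_gt0.
have d2d : d / 2 < d by rewrite ltr_pdivrMr// ltr_pMr// ltr1n.
have [] := P (d / 2); first by rewrite gtr0_norm.
have [] := P (- (d / 2)); first by rewrite normrN gtr0_norm.
rewrite !fE !ltr_norml sqrrN => h1 /andP[h2 _] h3 /andP[h4 _].
have : 0 < (d / 2) ^+ 2 * (c + e (d / 2) + (c + e (- (d / 2)))).
  by rewrite mulr_gt0 ?exprn_gt0//; lra.
lra.
Qed.

Lemma jet2_min_ge0 f a b c : jet 2 f a b c -> (\forall t \near (0 : R), a <= f t) -> 0 <= c.
Proof.
move=> /(jetZ (-1)) jf mf; rewrite -oppr_le0 -mulN1r; apply: (jet2_max_le0 jf).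
by apply: filterS mf => t; rewrite !mulN1r lerN2.
Qed.

End Jets.

(** * Frobenius and operator norms, symmetric and semidefinite matrices *)

Section Norms.
Variable R : realType.

(** With [A], [B], [S] the three sums, [A (A B - S^2)] is the sum of the squares of [A b - S a]. The
    case [A = 0] is separate because [A] is then cancelled. *)
Lemma Cauchy_Schwarz_sum (I : finType) (a b : I -> R) :
  (\sum_i a i * b i) ^+ 2 <= (\sum_i a i ^+ 2) * (\sum_i b i ^+ 2).
Proof.
set A := \sum_i a i ^+ 2; set B := \sum_i b i ^+ 2; set S := \sum_i _.
have A0 : 0 <= A by apply: sumr_ge0 => i _; exact: sqr_ge0.
have [Az|An] := eqVneq A 0.
  have az i : a i = 0.
    apply/eqP; rewrite -sqrf_eq0; move/eqP: Az.
    by rewrite psumr_eq0 => [/allP/(_ i (mem_index_enum _))//|j _]; exact: sqr_ge0.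
  have -> : S = 0 by apply: big1 => i _; rewrite az mul0r.
  by rewrite Az expr0n mul0r.
have Ap : 0 < A by rewrite lt_def An.
have : 0 <= \sum_i (A * b i - S * a i) ^+ 2 by apply: sumr_ge0 => i _; exact: sqr_ge0.
have -> : \sum_i (A * b i - S * a i) ^+ 2 = A * (A * B - S ^+ 2).
  transitivity (\sum_i (A ^+ 2 * b i ^+ 2 - 2 * A * S * (a i * b i) + S ^+ 2 * a i ^+ 2)).
    by apply: eq_bigr => i _; ring.
  by rewrite big_split sumrB -!mulr_sumr/= -/A -/B -/S; ring.
by rewrite pmulr_rge0// subr_ge0.
Qed.

Section Fnorm.
Variables m n : nat.
Implicit Types A B : 'M[R]_(m, n).

Lemma fnorm_ge0 A : 0 <= fnorm A.
Proof. exact: sqrtr_ge0. Qed.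

Lemma sqr_fnorm A : fnorm A ^+ 2 = \sum_i \sum_j A i j ^+ 2.
Proof.
by rewrite sqr_sqrtr//; apply: sumr_ge0 => i _; apply: sumr_ge0 => j _; exact: sqr_ge0.
Qed.

Lemma fnormZ c A : fnorm (c *: A) = `|c| * fnorm A.
Proof.
rewrite /fnorm -sqrtr_sqr -sqrtrM ?sqr_ge0//; congr Num.sqrt.
rewrite mulr_sumr; apply: eq_bigr => i _; rewrite mulr_sumr; apply: eq_bigr => j _.
by rewrite mxE exprMn.
Qed.

(** Stands in for the triangle inequality; the factor 2 in [opnorm_le_of_upper] absorbs the loss. *)
Lemma sqr_fnormB_le A B : fnorm (A - B) ^+ 2 <= 2 * fnorm A ^+ 2 + 2 * fnorm B ^+ 2.
Proof.
rewrite !sqr_fnorm !mulr_sumr -big_split; apply: ler_sum => i _ /=.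
rewrite !mulr_sumr -big_split; apply: ler_sum => j _ /=; rewrite !mxE.
by have := sqr_ge0 (A i j + B i j); nra.
Qed.

Lemma fnorm_eq0 A : fnorm A = 0 -> A = 0.
Proof.
move=> A0; have := sqr_fnorm A; rewrite A0 expr0n/= => /esym/eqP.
rewrite psumr_eq0 => [/allP H|i _]; last by apply: sumr_ge0 => j _; exact: sqr_ge0.
apply/matrixP => i j; rewrite mxE; have := H i (mem_index_enum _).
rewrite /= psumr_eq0 => [/allP/(_ j (mem_index_enum _))|k _]; last exact: sqr_ge0.
by rewrite /= sqrf_eq0 => /eqP.
Qed.

Lemma fnorm_tr A : fnorm A^T = fnorm A.
Proof.
rewrite /fnorm exchange_big; congr Num.sqrt.
by apply: eq_bigr => i _; apply: eq_bigr => j _; rewrite mxE.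
Qed.

End Fnorm.

Lemma fnorm_mulmx m n p (A : 'M[R]_(m, n)) (B : 'M[R]_(n, p)) :
  fnorm (A *m B) <= fnorm A * fnorm B.
Proof.
rewrite -(@ler_pXn2r _ 2)// ?nnegrE ?mulr_ge0 ?fnorm_ge0// exprMn !sqr_fnorm.
rewrite mulr_suml; apply: ler_sum => i _.
rewrite [X in _ <= _ * X]exchange_big mulr_sumr; apply: ler_sum => k _ /=.
by rewrite mxE; exact: Cauchy_Schwarz_sum.
Qed.

Lemma sqr_fnorm_row n (p : 'rV[R]_n) : fnorm p ^+ 2 = \sum_j p 0 j ^+ 2.
Proof. by rewrite sqr_fnorm big_ord1. Qed.

Lemma sqr_fnorm_col n (p : 'cV[R]_n) : fnorm p ^+ 2 = \sum_j p j 0 ^+ 2.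
Proof. by rewrite sqr_fnorm; apply: eq_bigr => j _; rewrite big_ord1. Qed.

Section Opnorm.
Variable n : nat.
Implicit Types (N : 'M[R]_n) (x : 'cV[R]_n) (p : 'rV[R]_n).

Lemma opnorm_ge N x : fnorm x = 1 -> fnorm (N *m x) <= opnorm N.
Proof.
move=> x1; apply: sup_upper_bound; last by exists x.
split; first by exists (fnorm (N *m x)), x.
exists (fnorm N) => _ [y /= y1 <-].
by have := fnorm_mulmx N y; rewrite y1 mulr1.
Qed.

Lemma opnorm_le N c : 0 <= c -> (forall x, fnorm x = 1 -> fnorm (N *m x) <= c) ->
  opnorm N <= c.
Proof.
move=> c0 H; rewrite /opnorm; set E := [set _ | _ in _].
(* In dimension 0 the unit sphere is empty and [sup] takes the value 0; here the sign of [c] is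
   used. *)
have [->|/set0P[y Ey]] := eqVneq E set0; first by rewrite sup0.
by apply: ge_sup; [exists y|move=> _ [x /= x1 <-]; exact: H].
Qed.

Lemma opnorm_ge0 N : 0 <= opnorm N.
Proof.
rewrite /opnorm; set E := [set _ | _ in _].
have [->|/set0P[y [x x1 _]]] := eqVneq E set0; first by rewrite sup0.
exact: le_trans (fnorm_ge0 _) (opnorm_ge N x1).
Qed.

Lemma opnorm_le_fnorm N : opnorm N <= fnorm N.
Proof.
apply: opnorm_le => [|x x1]; first exact: fnorm_ge0.
by have := fnorm_mulmx N x; rewrite x1 mulr1.
Qed.

Lemma opnorm_scalar c : 0 <= c -> opnorm (c%:M : 'M[R]_n) <= c.
Proof.
move=> c0; apply: opnorm_le => // x x1.
by rewrite mul_scalar_mx fnormZ x1 mulr1 ger0_norm.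
Qed.

(** The Frobenius norm gives the upper bound and the unit vector along [p] the lower one. Since they
    agree, the constants of ellipticity pass to quadratic forms without any dimensional factor. *)
Lemma opnorm_rank1 p t : 0 <= t ->
  t * fnorm p ^+ 2 <= opnorm (t *: (p^T *m p)) <= t * fnorm p ^+ 2.
Proof.
move=> t0; apply/andP; split; last first.
  apply: le_trans (opnorm_le_fnorm _) _.
  rewrite fnormZ ger0_norm// ler_wpM2l// expr2 -{1}(fnorm_tr p); exact: fnorm_mulmx.
have [p0|p0] := eqVneq (fnorm p) 0; first by rewrite p0 expr0n mulr0 opnorm_ge0.
have pp : 0 < fnorm p by rewrite lt_def p0 fnorm_ge0.
set x := (fnorm p)^-1 *: p^T.
have x1 : fnorm x = 1 by rewrite fnormZ fnorm_tr ger0_norm ?invr_ge0 ?ltW// mulVf.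
apply: le_trans (opnorm_ge _ x1).
have -> : t *: (p^T *m p) *m x = (t * fnorm p) *: p^T.
  rewrite -scalemxAl -mulmxA -!scalemxAr.
  have -> : p *m p^T = (fnorm p ^+ 2)%:M.
    apply/matrixP => i j; rewrite !ord1 !mxE eqxx mulr1n sqr_fnorm_row.
    by apply: eq_bigr => k _; rewrite mxE expr2.
  rewrite mul_mx_scalar !scalerA; congr (_ *: _).
  by rewrite expr2 !mulrA divfK.
by rewrite fnormZ fnorm_tr ger0_norm ?mulr_ge0 ?fnorm_ge0// expr2 mulrA.
Qed.

Lemma sym_rank1 p : Defs.symmetric (p^T *m p).
Proof. by rewrite /Defs.symmetric trmx_mul trmxK. Qed.

Lemma symD N1 N2 : Defs.symmetric N1 -> Defs.symmetric N2 -> Defs.symmetric (N1 + N2).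
Proof. by rewrite /Defs.symmetric linearD /= => -> ->. Qed.

Lemma symZ c N : Defs.symmetric N -> Defs.symmetric (c *: N).
Proof. by rewrite /Defs.symmetric linearZ /= => ->. Qed.

Lemma symB N1 N2 : Defs.symmetric N1 -> Defs.symmetric N2 -> Defs.symmetric (N1 - N2).
Proof. by rewrite /Defs.symmetric linearB /= => -> ->. Qed.

Lemma sym0 : Defs.symmetric (0 : 'M[R]_n).
Proof. exact: trmx0. Qed.

Lemma sym_scalar c : Defs.symmetric (c%:M : 'M[R]_n).
Proof. exact: tr_scalar_mx. Qed.

Lemma sym_sum (I : Type) (r : seq I) (G : I -> 'M[R]_n) :
  (forall i, Defs.symmetric (G i)) -> Defs.symmetric (\sum_(i <- r) G i).
Proof. by move=> H; apply: big_ind => //; [exact: sym0|exact: symD]. Qed.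

Lemma psdZ c N : 0 <= c -> psd N -> psd (c *: N).
Proof.
move=> c0 [sN N0]; split; first exact: symZ.
by move=> x; rewrite -scalemxAr -scalemxAl mxE mulr_ge0.
Qed.

Lemma psd_rank1 p : psd (p^T *m p).
Proof.
split; first exact: sym_rank1.
move=> x; rewrite mulmxA -mulmxA.
have -> : x^T *m p^T = (p *m x)^T by rewrite trmx_mul.
by rewrite !mxE big_ord1 mxE -expr2 sqr_ge0.
Qed.

Lemma psd_scalar c : 0 <= c -> psd (c%:M : 'M[R]_n).
Proof.
move=> c0; split; first exact: sym_scalar.
move=> x; rewrite mul_mx_scalar -scalemxAl !mxE mulr_ge0//.
by apply: sumr_ge0 => i _; rewrite mxE -expr2 sqr_ge0.
Qed.

End Opnorm.

End Norms.

(** * The gradient of the operator as an elliptic supporting functional *)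

Section Linearization.
Variables (R : realType) (n : nat).
Implicit Types (A M N P : 'M[R]_n) (p : 'rV[R]_n) (F : 'M[R]_n -> R).

Definition frob A N : R := \sum_i \sum_j A i j * N i j.

Lemma frobD A N P : frob A (N + P) = frob A N + frob A P.
Proof.
rewrite /frob -big_split; apply: eq_bigr => i _; rewrite -big_split; apply: eq_bigr => j _.
by rewrite mxE mulrDr.
Qed.

Lemma frobZ A c N : frob A (c *: N) = c * frob A N.
Proof.
rewrite /frob mulr_sumr; apply: eq_bigr => i _; rewrite mulr_sumr; apply: eq_bigr => j _.
by rewrite mxE mulrCA.
Qed.

Lemma frobN A N : frob A (- N) = - frob A N.
Proof. by rewrite -scaleN1r frobZ mulN1r. Qed.

(** Positivity, two-sided ellipticity on rank-one matrices, and a trace bound. The trace is at most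
    [Lam], not [n * Lam], because ellipticity is measured in the operator norm, where the identity
    has norm at most 1. *)
Definition elliptic_form (lam Lam : R) A := [/\
  forall N, psd N -> 0 <= frob A N,
  forall p, lam * fnorm p ^+ 2 <= frob A (p^T *m p) <= Lam * fnorm p ^+ 2 &
  frob A 1%:M <= Lam].

(** [C1_sym] gives only separate directional derivatives. Their additivity follows from continuity
    along symmetric matrices, and [A] is then read off on a spanning family. *)
Lemma derive_sym_linear F M : C1_sym F -> Defs.symmetric M ->
  exists A, forall N, Defs.symmetric N -> 'D_N F M = frob A N.
Proof.
move=> C1 sM.
have dD N1 N2 : Defs.symmetric N1 -> Defs.symmetric N2 ->
    'D_(N1 + N2) F M = 'D_N1 F M + 'D_N2 F M.
  move=> s1 s2; have [d1 _] := C1 _ s1; have [d2 c2] := C1 _ s2.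
  have [||_ //] := @is_derive_dirD R _ (@Sym R n) F M N1 N2 _ d2 _ (d1 _ sM).
    by exists 1 => //= t _ s _; exact: symD sM (symZ t (symD s1 (symZ s s2))).
  by move/subspace_continuousP : c2; exact.
have dZ c N : Defs.symmetric N -> 'D_(c *: N) F M = c * 'D_N F M.
  by move=> sN; have [dN _] := C1 _ sN; have [_ ->] := is_derive_dirZ c (dN _ sM).
have dsum (I : Type) (r : seq I) (G : I -> 'M[R]_n) : (forall i, Defs.symmetric (G i)) ->
    'D_(\sum_(i <- r) G i) F M = \sum_(i <- r) 'D_(G i) F M.
  move=> sG; elim: r => [|i r IH]; first by rewrite !big_nil derive0.
  by rewrite !big_cons dD ?IH//; exact: sym_sum.
(* Matrix units are not admissible directions, so they are symmetrized; summing over all pairs [i],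
   [j] avoids treating the diagonal apart. *)
pose S i j : 'M[R]_n := 2^-1 *: (delta_mx i j + delta_mx j i).
have sS i j : Defs.symmetric (S i j).
  by rewrite /Defs.symmetric /S linearZ linearD /= !trmx_delta addrC.
exists (\matrix_(i, j) 'D_(S i j) F M) => N sN.
have NE : N = \sum_i \sum_j N i j *: S i j.
  have E : \sum_i \sum_j N i j *: delta_mx j i = N.
    rewrite -[RHS]sN [N in RHS]matrix_sum_delta raddf_sum; apply: eq_bigr => i _.
    by rewrite raddf_sum; apply: eq_bigr => j _ /=; rewrite linearZ /= trmx_delta.
  (* The average of two expansions of [N], one in the matrix units and one, by symmetry, in their
     transposes. *)
  transitivity (2^-1 *: (N + N)).
    by rewrite -mulr2n -(scaler_nat 2 N) scalerA mulVf ?scale1r// pnatr_eq0.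
  rewrite -{2}E {1}[N]matrix_sum_delta -big_split scaler_sumr; apply: eq_bigr => i _ /=.
  rewrite -big_split scaler_sumr; apply: eq_bigr => j _ /=.
  by rewrite /S -scalerDr !scalerA mulrC.
rewrite {1}NE dsum => [|i]; last by apply: sym_sum => j; exact: symZ.
rewrite /frob; apply: eq_bigr => i _; rewrite dsum => [|j]; last exact: symZ.
by apply: eq_bigr => j _; rewrite dZ// mxE mulrC.
Qed.

Lemma linearization lam Lam F M : 0 <= lam -> 0 <= Lam -> C1_sym F -> quasiconcave F ->
  uniformly_elliptic F lam Lam -> Defs.symmetric M ->
  exists2 A, elliptic_form lam Lam A &
    forall P, Defs.symmetric P -> F M <= F P -> 0 <= frob A (P - M).
Proof.
move=> lam0 Lam0 C1 qF eF sM; have [A AE] := derive_sym_linear C1 sM.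
have dF N : Defs.symmetric N -> derivable F M N by move=> sN; have [+ _] := C1 N sN; exact.
exists A; first split.
- move=> N pN; have sN := pN.1; rewrite -AE//; apply: derive_ge => [|t /andP[t0 _]].
    exact: dF.
  rewrite mul0r; have /andP[+ _] := eF M _ sM (psdZ (ltW t0) pN).
  by apply: le_trans; rewrite mulr_ge0// opnorm_ge0.
- move=> p; rewrite -AE; last exact: sym_rank1.
  have dp := dF _ (sym_rank1 p).
  apply/andP; split;
    [apply: derive_ge => // t /andP[t0 _]|apply: derive_le => // t /andP[t0 _]];
    have /andP[h1 h2] := eF M _ sM (psdZ (ltW t0) (psd_rank1 p));
    have /andP[h3 h4] := opnorm_rank1 p (ltW t0).
    by apply: le_trans h1; rewrite mulrAC -mulrA ler_wpM2l.
  by apply: le_trans h2 _; rewrite mulrAC -mulrA ler_wpM2l.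
- rewrite -AE; last exact: sym_scalar.
  apply: derive_le => [|t /andP[t0 _]]; first by apply: dF; exact: sym_scalar.
  rewrite scale_scalar_mx mulr1.
  have /andP[_ +] := eF M _ sM (psd_scalar n (ltW t0)); move/le_trans; apply.
  by rewrite ler_wpM2l// opnorm_scalar// ltW.
(* By quasiconcavity the segment from [M] to [P] stays in the set where [F] is at least [F M], so
   the difference quotients towards [P] are nonnegative. *)
move=> P sP MP; rewrite -AE; last exact: symB.
apply: derive_ge => [|t /andP[t0 t1]]; first by apply: dF; exact: symB.
have t01 : 0 <= t <= 1 by rewrite ltW.
have := qF P M t sP sM t01; rewrite min_r// mul0r subr_ge0.
by congr (_ <= F _); rewrite scalerBr scalerBl scale1r addrCA.
Qed.

(* Ellipticity alone turns a one-sided bound at a zero of [F] into a bound of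
   the norm: compare [M] and [0] with [mu%:M]. *)
Lemma opnorm_le_of_upper lam Lam F M mu : 0 < lam -> 0 <= Lam -> 0 <= mu ->
  uniformly_elliptic F lam Lam -> F 0 = 0 -> F M = 0 -> Defs.symmetric M ->
  (forall x : 'cV[R]_n, (x^T *m M *m x) 0 0 <= mu * fnorm x ^+ 2) ->
  opnorm M <= 2 * (1 + Lam / lam) * mu.
Proof.
move=> lam0 Lam0 mu0 eF F0 FM sM Mmu.
have pN : psd (mu%:M - M).
  split; first by apply: symB => //; exact: sym_scalar.
  move=> x; rewrite mulmxBr mulmxBl mxE [X in _ + X]mxE subr_ge0.
  apply: le_trans (Mmu x) _; rewrite mul_mx_scalar -scalemxAl mxE sqr_fnorm_col.
  rewrite ler_wpM2l// mxE le_eqVlt; apply/orP; left; apply/eqP.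
  by apply: eq_bigr => i _; rewrite mxE expr2.
(* Since [F] vanishes at [M] and at 0, both increments equal [F mu%:M]: it is at least [lam] times
   the norm of [mu%:M - M] and at most [Lam * mu]. *)
have /andP[h1 _] := eF M _ sM pN; have /andP[_ h2] := eF 0 _ (@sym0 R n) (psd_scalar n mu0).
rewrite [M + _]addrC subrK FM subr0 in h1; rewrite add0r F0 subr0 in h2.
have Nle : opnorm (mu%:M - M) <= Lam / lam * mu.
  rewrite mulrAC ler_pdivlMr// mulrC; apply: le_trans h1 (le_trans h2 _).
  by rewrite ler_wpM2l// opnorm_scalar.
have k0 : 0 <= Lam / lam by rewrite divr_ge0// ltW.
apply: opnorm_le => [|x x1]; first by rewrite !mulr_ge0// addr_ge0.
rewrite -(@ler_pXn2r _ 2)// ?nnegrE ?mulr_ge0 ?fnorm_ge0 ?addr_ge0//.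
have -> : M *m x = mu *: x - (mu%:M - M) *m x.
  by rewrite mulmxBl mul_scalar_mx opprB addrC subrK.
apply: le_trans (sqr_fnormB_le _ _) _.
rewrite fnormZ x1 mulr1 ger0_norm//.
have := le_trans (opnorm_ge (mu%:M - M) x1) Nle; have := fnorm_ge0 ((mu%:M - M) *m x).
move: k0; set k := Lam / lam; set f := fnorm _ => k0 f0 fk.
have km0 : 0 <= k * mu by rewrite mulr_ge0.
have : f ^+ 2 <= (k * mu) ^+ 2 by rewrite ler_pXn2r// nnegrE.
have : 0 <= mu * (k * mu) by rewrite mulr_ge0.
have := sqr_ge0 mu; have := sqr_ge0 (k * mu).
by rewrite !exprMn; nra.
Qed.

End Linearization.

(** * Topology of Euclidean balls *)

Section Balls.
Variables (R : realType) (n : nat).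
Implicit Types (x y : 'rV[R]_n) (r : R).

Lemma cvg_sumr (T : topologicalType) (F : set_system T) {FF : Filter F} (I : Type)
    (s : seq I) (f : I -> T -> R) (l : I -> R) :
  (forall i, f i @ F --> l i) -> (fun z => \sum_(i <- s) f i z) @ F --> \sum_(i <- s) l i.
Proof.
move=> H; elim: s => [|i s IH].
  by under eq_fun do rewrite big_nil; rewrite big_nil; exact: cvg_cst.
by under eq_fun do rewrite big_cons; rewrite big_cons; exact: cvgD.
Qed.

(** Row vectors carry the topology of the sup norm. The squared Euclidean norm is a polynomial in
    the coordinates, and openness and closedness of balls are pulled back through it. *)
Lemma continuous_sqr_fnorm x : {for x, continuous (fun y => fnorm y ^+ 2)}.
Proof.
rewrite (_ : (fun y => fnorm y ^+ 2) = (fun y => \sum_j y 0 j ^+ 2)); last first.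
  by apply/funext => y; rewrite sqr_fnorm_row.
apply: (@cvg_sumr _ (nbhs x) _ _ _ (fun j y => y 0 j ^+ 2)) => i.
apply: (@cvg_comp _ _ _ (fun y : 'rV[R]_n => y 0 i) (fun t => t ^+ 2)).
  exact: coord_continuous.
exact: exprn_continuous.
Qed.

Lemma fnorm_lt r x : 0 <= r -> (fnorm x < r) = (fnorm x ^+ 2 < r ^+ 2).
Proof. by move=> r0; rewrite ltr_pXn2r// nnegrE fnorm_ge0. Qed.

Lemma fnorm_le r x : 0 <= r -> (fnorm x <= r) = (fnorm x ^+ 2 <= r ^+ 2).
Proof. by move=> r0; rewrite ler_pXn2r// nnegrE fnorm_ge0. Qed.

Lemma open_fnorm_lt r : 0 <= r -> open [set x : 'rV[R]_n | fnorm x < r].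
Proof.
move=> r0.
rewrite (_ : mkset _ = (fun y : 'rV[R]_n => fnorm y ^+ 2) @^-1` [set t | t < r ^+ 2]).
  by apply: open_comp => [x _|]; [exact: continuous_sqr_fnorm|exact: open_lt].
by apply/seteqP; split => x /=; rewrite fnorm_lt.
Qed.

Lemma norm_coord_le_fnorm x i : `|x 0 i| <= fnorm x.
Proof.
rewrite -(@ler_pXn2r _ 2)// ?nnegrE ?fnorm_ge0// sqr_fnorm_row (bigD1 i)//=.
by rewrite real_normK ?num_real// lerDl; apply: sumr_ge0 => j _; exact: sqr_ge0.
Qed.

Lemma compact_fnorm_le r : 0 <= r -> compact [set x : 'rV[R]_n | fnorm x <= r].
Proof.
move=> r0; apply: bounded_closed_compact.
  exists r; split; first exact: num_real.
  move=> M rM x /= xr; apply: le_trans (ltW rM); rewrite [leLHS]/Num.norm/= mx_normrE.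
  apply: bigmax_le => // -[i j] _ /=; rewrite ord1.
  exact: le_trans (norm_coord_le_fnorm _ _) xr.
rewrite (_ : mkset _ = (fun y : 'rV[R]_n => fnorm y ^+ 2) @^-1` [set t | t <= r ^+ 2]).
  by apply: preimage_closed => [x _|]; [exact: continuous_sqr_fnorm|exact: closed_le].
by apply/seteqP; split => x /=; rewrite fnorm_le.
Qed.

Lemma near_line x y (P : set 'rV[R]_n) : (\forall z \near x, P z) ->
  \forall t \near (0 : R), P (x + t *: y).
Proof.
move=> /(near_line2 0 y); apply: filterS => t /(_ 1 1).
by rewrite lexx ler01 scale1r scale1r add0r; exact.
Qed.

Lemma near_gt0 (g : 'rV[R]_n -> R) x : {for x, continuous g} -> 0 < g x ->
  \forall y \near x, 0 < g y.
Proof. by move=> cg gx; apply: (cvgr_gt _ cg). Qed.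

End Balls.

(** * The maximum principle for Bernstein's auxiliary function *)

Section Bernstein.
Variables (R : realType) (n : nat).
Implicit Types (x y xi b q : 'rV[R]_n) (A G H N : 'M[R]_n) (g v : 'rV[R]_n -> R).

Definition dot b xi : R := \sum_i b 0 i * xi 0 i.
(** The form [xi N xi^T], encoded as a pairing with a rank-one matrix so that linearity in [N] is
    inherited from [frob]. *)
Definition quad N xi : R := frob N (xi^T *m xi).

Lemma quadE N xi : quad N xi = \sum_i \sum_j N i j * (xi 0 i * xi 0 j).
Proof.
apply: eq_bigr => i _; apply: eq_bigr => j _.
by rewrite !mxE big_ord1 mxE.
Qed.

Lemma quad_col N (z : 'cV[R]_n) : (z^T *m N *m z) 0 0 = quad N z^T.
Proof.
rewrite quadE !mxE exchange_big /=; apply: eq_bigr => j _; rewrite !mxE mulr_suml.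
by apply: eq_bigr => i _; rewrite !mxE; ring.
Qed.

Lemma frobC A N : frob A N = frob N A.
Proof. by apply: eq_bigr => i _; apply: eq_bigr => j _; rewrite mulrC. Qed.

Lemma quadD N H xi : quad (N + H) xi = quad N xi + quad H xi.
Proof. by rewrite /quad frobC frobD !(frobC (_ *m _)). Qed.

Lemma quadZ c N xi : quad (c *: N) xi = c * quad N xi.
Proof. by rewrite /quad frobC frobZ (frobC (_ *m _)). Qed.

Lemma quad_rank1 b xi : quad (b^T *m b) xi = dot b xi ^+ 2.
Proof.
rewrite quadE expr2 /dot mulr_suml; apply: eq_bigr => i _.
by rewrite mulr_sumr; apply: eq_bigr => j _; rewrite !mxE big_ord1 mxE; ring.
Qed.

Lemma quad1 xi : quad 1%:M xi = fnorm xi ^+ 2.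
Proof.
rewrite quadE sqr_fnorm_row; apply: eq_bigr => i _; rewrite (bigD1 i)//= big1.
  by rewrite mxE eqxx mul1r addr0 expr2.
by move=> j ji; rewrite mxE eq_sym (negbTE ji) mul0r.
Qed.

Lemma dotDl b q xi : dot (b + q) xi = dot b xi + dot q xi.
Proof. by rewrite -big_split; apply: eq_bigr => i _; rewrite mxE mulrDl. Qed.

Lemma dotZl c b xi : dot (c *: b) xi = c * dot b xi.
Proof. by rewrite /dot mulr_sumr; apply: eq_bigr => i _; rewrite mxE mulrA. Qed.

Lemma sqr_fnormD_line x xi (t : R) :
  fnorm (x + t *: xi) ^+ 2 = fnorm x ^+ 2 + 2 * dot x xi * t + fnorm xi ^+ 2 * t ^+ 2.
Proof.
rewrite !sqr_fnorm_row /dot mulr_sumr !mulr_suml -!big_split.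
by apply: eq_bigr => i _; rewrite /= !mxE; ring.
Qed.

(** An expansion on each line through [x], without uniformity in [xi]: the test at a maximum is made
    line by line. *)
Definition jet2_at (f : 'rV[R]_n -> R) x b G :=
  forall xi, jet 2 (fun t => f (x + t *: xi)) (f x) (dot b xi) (quad G xi / 2).

(** A pointwise interface serving both estimates: [g] is a subsolution, [v] times its image has the
    good sign, and the gradient [q] of [v] dominates [g]. The coefficients [A] may change
    arbitrarily with [x]. *)
Definition bernstein_data (lam Lam : R) g v x := exists A b G q H, [/\
  elliptic_form lam Lam A, Defs.symmetric G, Defs.symmetric H,
  jet2_at g x b G & jet2_at v x q H] /\
  [/\ 0 <= frob A G, 0 <= v x * frob A H & g x ^+ 2 <= fnorm q ^+ 2].

(* The Hessian of [(eta g)^2 + gam v^2] with [eta y = rho^2 - |y|^2], after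
   completing the square in the cross terms, is twice the matrix [K] below. *)
Lemma no_interior_max (lam Lam rho : R) g v x : 0 < lam -> 0 < Lam -> 0 <= rho <= 1 ->
  let w y := ((rho ^+ 2 - fnorm y ^+ 2) * g y) * ((rho ^+ 2 - fnorm y ^+ 2) * g y)
             + 15 * Lam / lam * (v y * v y) in
  fnorm x <= rho -> 0 < g x -> bernstein_data lam Lam g v x ->
  ~ (forall xi, \forall t \near (0 : R), w (x + t *: xi) <= w x).
Proof.
move=> lam0 Lam0 /andP[rho0 rho1] w xrho gx0 [A [b [G [q [H []]]]]].
move=> [[A1 A2 A3] sG sH jg jv] [AG AH gq] wmax.
set eta := rho ^+ 2 - fnorm x ^+ 2; set gam := 15 * Lam / lam.
pose p := eta *: b - (4 * g x) *: x.
pose K := p^T *m p + (- 12 * g x ^+ 2) *: (x^T *m x) + (eta ^+ 2 * g x) *: G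
   + (- 2 * eta * g x ^+ 2) *: 1%:M + gam *: (q^T *m q) + (gam * v x) *: H.
have sK : Defs.symmetric K.
  rewrite /K; do !apply: symD => //; try apply: symZ; try exact: sym_rank1; try done.
  exact: sym_scalar.
have quadK xi : quad K xi <= 0.
  have jeta : jet 2 (fun t => rho ^+ 2 - fnorm (x + t *: xi) ^+ 2)
      eta (- 2 * dot x xi) (- fnorm xi ^+ 2).
    exists (fun=> 0) => [|t]; first exact: cvg_cst.
    by rewrite sqr_fnormD_line /eta; ring.
  have jh := jetM jeta (jg xi).
  have jw := jetD (jetM jh jh) (jetZ gam (jetM (jv xi) (jv xi))).
  have := jet2_max_le0 jw (wmax xi).
  rewrite /K !quadD !quadZ !quad_rank1 quad1.
  have -> : dot p xi = eta * dot b xi - 4 * g x * dot x xi.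
    by rewrite /p dotDl -scaleNr !dotZl; ring.
  by congr (_ <= _); field.
(* At a maximum [- K] is semidefinite, so [<A, K> <= 0]; the estimates below show that [<A, K>] is
   positive. *)
have : 0 <= frob A (- K).
  apply: A1; split.
    by rewrite -scaleN1r; exact: symZ.
  by move=> z; rewrite quad_col -scaleN1r quadZ mulN1r oppr_ge0.
rewrite frobN oppr_ge0 leNgt => /negP; apply.
rewrite /K !frobD !frobZ.
have eta1 : eta <= 1.
  rewrite /eta; have := sqr_ge0 (fnorm x); have : rho ^+ 2 <= 1 by rewrite expr_le1.
  lra.
have eta0 : 0 <= eta by rewrite /eta subr_ge0 -fnorm_le.
have x1 : fnorm x ^+ 2 <= 1 by rewrite expr_le1 ?fnorm_ge0// (le_trans xrho).
have g2 : 0 < g x ^+ 2 by rewrite exprn_gt0.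
have t1 : 0 <= frob A (p^T *m p) by apply: A1; exact: psd_rank1.
have t2 : g x ^+ 2 * frob A (x^T *m x) <= g x ^+ 2 * Lam.
  rewrite ler_pM2l//; have /andP[_ h] := A2 x; apply: le_trans h _.
  by rewrite ler_piMr// ltW.
have t3 : 0 <= eta ^+ 2 * g x * frob A G.
  by rewrite mulr_ge0// mulr_ge0 ?sqr_ge0// ltW.
have t4 : eta * g x ^+ 2 * frob A 1%:M <= g x ^+ 2 * Lam.
  apply: le_trans (ler_wpM2l _ A3) _; first by rewrite mulr_ge0// ltW.
  by rewrite -mulrA ler_piMl// mulr_ge0// ltW.
have gam0 : 0 < gam by rewrite /gam divr_gt0// mulr_gt0.
(* In units of [g x ^+ 2 * Lam], the negative terms of [<A, K>] cost at most 12 (from [x^T *m x])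
   and 2 (from the identity). The constant 15 in [gam] exceeds their sum. *)
have t5 : 15 * (g x ^+ 2 * Lam) <= gam * frob A (q^T *m q).
  have /andP[h _] := A2 q.
  have : gam * (lam * g x ^+ 2) <= gam * frob A (q^T *m q).
    by rewrite ler_pM2l//; apply: le_trans h; rewrite ler_pM2l.
  apply: le_trans; rewrite le_eqVlt; apply/orP; left; apply/eqP.
  by rewrite /gam; field; rewrite gt_eqF.
have t6 : 0 <= gam * v x * frob A H by rewrite -mulrA mulr_ge0// ltW.
have t7 : 0 < g x ^+ 2 * Lam by rewrite mulr_gt0.
lra.
Qed.

(** At a maximum point of [w] on the closed ball, either the cutoff or the positive part of [g]
    vanishes, and only the term in [v] remains, or [no_interior_max] gives a contradiction. *)
Lemma bernstein (lam Lam rho K : R) g v : 0 < lam -> 0 < Lam -> 0 <= rho <= 1 -> 0 <= K ->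
  (forall x, fnorm x <= rho -> {for x, continuous g}) ->
  (forall x, fnorm x <= rho -> {for x, continuous v}) ->
  (forall x, fnorm x <= rho -> `|v x| <= K) ->
  (forall x, fnorm x < rho -> 0 < g x -> bernstein_data lam Lam g v x) ->
  forall x, fnorm x <= rho ->
    (rho ^+ 2 - fnorm x ^+ 2) * g x <= Num.sqrt (15 * Lam / lam) * K.
Proof.
move=> lam0 Lam0 /andP[rho0 rho1] K0 cg cv vK data x xrho.
set gam := 15 * Lam / lam; have gam0 : 0 < gam by rewrite /gam divr_gt0// mulr_gt0.
(* Squaring would lose the sign of [g], and the differential inequalities are available only where
   [g] is positive. *)
pose gp y := Num.max (g y) 0.
pose h y := (rho ^+ 2 - fnorm y ^+ 2) * gp y.
pose w y := h y * h y + gam * (v y * v y).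
have cw y : fnorm y <= rho -> {for y, continuous w}.
  move=> yrho.
  have ch : {for y, continuous h}.
    apply: (@continuousM _ _ (fun z => rho ^+ 2 - fnorm z ^+ 2) gp).
      apply: (@continuousB _ _ _ (cst (rho ^+ 2)) (fun z => fnorm z ^+ 2)).
        exact: cst_continuous.
      exact: continuous_sqr_fnorm.
    by apply: (@continuous_max _ _ g (cst 0)); [exact: cg|exact: cst_continuous].
  have vy := cv y yrho.
  apply: (@continuousD _ _ _ (fun z => h z * h z) (fun z => gam * (v z * v z))).
    exact: continuousM.
  apply: (@continuousM _ _ (cst gam) (fun z => v z * v z)); first exact: cst_continuous.
  exact: continuousM.
have Brho : [set y : 'rV[R]_n | fnorm y <= rho] !=set0 by exists x.
have [|c] := @compact_EVT_max _ R w _ Brho (@compact_fnorm_le R n _ rho0).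
  by apply: continuous_in_subspaceT => y; rewrite inE => yrho; exact: cw.
rewrite inE /= => crho cmax.
have vK2 y : fnorm y <= rho -> v y * v y <= K ^+ 2.
  by move=> yr; rewrite -expr2 -real_normK ?num_real// ler_pXn2r ?nnegrE// vK.
suff wc : w c <= gam * K ^+ 2.
  have : h x ^+ 2 <= (Num.sqrt gam * K) ^+ 2.
    rewrite [leRHS]exprMn sqr_sqrtr ?(ltW gam0)//.
    have : w x <= gam * K ^+ 2 by apply: le_trans wc; apply: cmax; rewrite inE.
    move=> wx; apply: le_trans wx; rewrite /w expr2 lerDl mulr_ge0// ?(ltW gam0)//.
    by rewrite -expr2 sqr_ge0.
  have eta0 : 0 <= rho ^+ 2 - fnorm x ^+ 2 by rewrite subr_ge0 -fnorm_le.
  rewrite ler_pXn2r ?nnegrE ?mulr_ge0 ?sqrtr_ge0// /gp ?le_max ?lexx ?orbT//.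
  by apply: le_trans; rewrite /h ler_wpM2l// /gp le_max lexx.
have hz : h c = 0 -> w c <= gam * K ^+ 2.
  by move=> hc; rewrite /w hc mul0r add0r ler_pM2l// vK2.
have [gc|gc] := leP (g c) 0.
  by apply: hz; rewrite /h /gp max_r// mulr0.
move: (crho); rewrite le_eqVlt => /orP[/eqP cr|cr].
  by apply: hz; rewrite /h cr subrr mul0r.
(* Near [c] the function [g] stays positive, so the positive part may be dropped and [w] is the
   function of [no_interior_max]. *)
exfalso; have rr : 0 <= rho <= 1 by rewrite rho0.
apply: (no_interior_max lam0 Lam0 rr crho gc (data c cr gc)) => xi.
have n1 : \forall y \near c, fnorm y < rho.
  exact: (open_nbhs_nbhs (conj (open_fnorm_lt rho0) cr)).
have n2 := near_gt0 (cg c crho) gc.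
have n3 : \forall y \near (c : 'rV[R]_n), fnorm y < rho /\ 0 < g y by apply: filterI.
apply: (filterS _ (near_line xi n3)) => t [/= h1 h2].
have := cmax (c + t *: xi); rewrite inE => /(_ (ltW h1)).
by rewrite /w /h /gp (max_l (ltW h2)) (max_l (ltW gc)).
Qed.

End Bernstein.

(** * Iterated partial derivatives of [u] inside the unit ball *)

Section Partials.
Variables (R : realType) (n m : nat) (u : 'rV[R]_n -> R).
Hypothesis Hu : Ck_cball m 0 1 u.
Implicit Types (x y xi e : 'rV[R]_n) (s : seq 'I_n).

Lemma eball0P r x : eball 0 r x <-> fnorm x < r.
Proof. by rewrite /eball /= subr0. Qed.

Lemma near_unit_ball x : fnorm x < 1 -> \forall y \near x, fnorm y < 1.
Proof. by move=> x1; exact: (open_nbhs_nbhs (conj (open_fnorm_lt ler01) x1)). Qed.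

Lemma dpart_derivable s i x : (size s < m)%N -> fnorm x < 1 ->
  derivable (dpart s u) x (evec R i).
Proof. by move=> sm /eball0P; exact: Hu.1. Qed.

Lemma dpart_continuous s x : (size s <= m)%N -> fnorm x < 1 ->
  {for x, continuous (dpart s u)}.
Proof.
move=> sm x1; have [g [/subspace_continuousP cg gE]] := Hu.2 s sm.
have xb : ecball 0 1 x by rewrite /ecball /= subr0 ltW.
apply/(cvgrPdist_lt (FF := nbhs_filter x)) => e e0.
have /cvgrPdist_lt/(_ e e0) := cg x xb; rewrite near_withinE => ng.
near=> y; have y1 : fnorm y < 1 by near: y; exact: near_unit_ball.
rewrite -!gE; [|exact/eball0P|exact/eball0P].
have yb : ecball 0 1 y by rewrite /ecball /= subr0 ltW.
by move: yb; near: y.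
Unshelve. all: by end_near. Qed.

(** The direction is built up one coordinate at a time, continuity of the newly added partial
    derivative giving additivity. *)
Lemma dpart_is_derive s x xi : (size s < m)%N -> fnorm x < 1 ->
  is_derive x xi (dpart s u) (\sum_i xi 0 i * dpart (i :: s) u x).
Proof.
move=> sm x1; rewrite {1}[xi]row_sum_delta.
elim: (index_enum _) => [|i r IH]; first by rewrite !big_nil; exact: is_derive0.
(* The new coordinate has to be the second summand: its derivative is known on the whole ball, that
   of the accumulated sum only at [x]. *)
rewrite !big_cons addrC [X in is_derive _ _ _ X]addrC; set c := xi 0 i.
have dc y : fnorm y < 1 -> is_derive y (c *: evec R i) (dpart s u) (c * dpart (i :: s) u y).
  by move=> y1; apply: is_derive_dirZ; exact: dpart_derivable.
set a := \sum_(j <- r) _ in IH *; set da := \sum_(j <- r) _ in IH *.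
have [d1 <-] := IH; have [d2 <-] := dc x x1.
apply: (@is_derive_dirD _ _ [set y | fnorm y < 1]).
- have := near_line2 a (c *: evec R i) (near_unit_ball x1).
  apply: filterS => t H r0 r01; have := H 1 r0; rewrite scale1r; apply => //.
  by rewrite ler01 lexx.
- by move=> y /dc[].
- have cd : {for x, continuous (fun y => c * dpart (i :: s) u y)}.
    apply: (@continuousM _ _ (cst c) (dpart (i :: s) u)); first exact: cst_continuous.
    exact: dpart_continuous.
  apply/cvgrPdist_lt => eps e0; rewrite near_withinE.
  move/cvgrPdist_lt : cd => /(_ eps e0); apply: filterS => y H /dc[_ ->].
  by have [_ ->] := dc x x1.
- exact: d1.
Qed.

Lemma dpart_line s x xi : (size s < m)%N -> fnorm x < 1 ->
  \forall t \near (0 : R), is_derive (t : R) 1 (fun t => dpart s u (x + t *: xi))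
     (\sum_i xi 0 i * dpart (i :: s) u (x + t *: xi)).
Proof.
move=> sm /near_unit_ball/(near_line xi); apply: filterS => t xt.
have [d1 <-] := dpart_is_derive xi sm xt.
exact: is_derive_line.
Qed.

Lemma dpart_jet1 s x xi : (size s < m)%N -> fnorm x < 1 ->
  jet 1 (fun t => dpart s u (x + t *: xi)) (dpart s u x)
    (\sum_i xi 0 i * dpart (i :: s) u x) 0.
Proof.
move=> sm x1; have := nbhs_singleton (dpart_line xi sm x1).
by move/is_derive_jet1; rewrite !scale0r !addr0.
Qed.

Lemma dpart_jet2 s x : ((size s).+1 < m)%N -> fnorm x < 1 ->
  jet2_at (dpart s u) x (\row_i dpart (i :: s) u x)
    (\matrix_(i, j) dpart [:: i, j & s] u x).
Proof.
move=> sm x1 xi.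
have -> : dot (\row_i dpart (i :: s) u x) xi = \sum_i xi 0 i * dpart (i :: s) u x.
  by apply: eq_bigr => i _; rewrite mxE mulrC.
have -> : quad (\matrix_(i, j) dpart [:: i, j & s] u x) xi =
    \sum_j xi 0 j * \sum_i xi 0 i * dpart [:: i, j & s] u x.
  rewrite quadE exchange_big /=; apply: eq_bigr => j _; rewrite mulr_sumr.
  by apply: eq_bigr => i _; rewrite mxE; ring.
have := @jet1_jet2 R _ _ _ _ (dpart_line xi (ltnW sm) x1).
rewrite scale0r addr0; apply.
rewrite [X in jet _ _ _ _ X](_ : 0 = \sum_i xi 0 i * 0); last first.
  by rewrite big1// => i _; rewrite mulr0.
apply: (@jet_sum R 1 n (fun i t => xi 0 i * dpart (i :: s) u (x + t *: xi))) => i.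
by apply: jetZ; exact: dpart_jet1.
Qed.

Lemma dpart_swap s i j x : ((size s).+1 < m)%N -> fnorm x < 1 ->
  dpart [:: i, j & s] u x = dpart [:: j, i & s] u x.
Proof.
move=> sm x1.
apply: (@derive_mixedC R _ [set y | fnorm y < 1] (dpart s u) x (evec R j) (evec R i)).
- exact: open_fnorm_lt.
- exact: x1.
- by move=> y; apply: dpart_derivable; exact: ltnW.
- by move=> y; apply: dpart_derivable; exact: ltnW.
- by move=> y; exact: (@dpart_derivable (j :: s)).
- by move=> y; exact: (@dpart_derivable (i :: s)).
- exact: (@dpart_continuous [:: i, j & s]).
- exact: (@dpart_continuous [:: j, i & s]).
Qed.

(** Exchanging inner derivatives under an outer one requires agreement on a neighbourhood, not only
    at [x]. *)
Lemma eq_dpart_cons s t i x : (forall y, fnorm y < 1 -> dpart s u y = dpart t u y) ->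
  fnorm x < 1 -> dpart (i :: s) u x = dpart (i :: t) u x.
Proof.
by move=> H /near_unit_ball nx; apply: near_eq_derive; apply: filterS nx.
Qed.

(** The head of the list is the derivative taken last. The identity turns the Hessian of [u_k] into
    the [k]-derivative of the Hessian of [u]. *)
Lemma dpart_rot s i j k x : ((size s).+2 < m)%N -> fnorm x < 1 ->
  dpart [:: i, j, k & s] u x = dpart [:: k, i, j & s] u x.
Proof.
move=> sm x1; transitivity (dpart [:: i, k, j & s] u x); last exact: (@dpart_swap (j :: s)).
apply: (@eq_dpart_cons [:: j, k & s] [:: k, j & s]); last exact: x1.
by move=> y y1; exact: (@dpart_swap s j k y (ltnW sm) y1).
Qed.

Lemma dpart_rot2 i j k l x : (3 < m)%N -> fnorm x < 1 ->
  dpart [:: i; j; k; l] u x = dpart [:: k; l; i; j] u x.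
Proof.
move=> m3 x1; transitivity (dpart [:: k; i; j; l] u x); first exact: (@dpart_rot [:: l]).
apply: (@eq_dpart_cons [:: i; j; l] [:: l; i; j]); last exact: x1.
by move=> y y1; exact: (@dpart_rot [::] i j l y (ltnW m3) y1).
Qed.

Lemma hessianE x : hessian u x = \matrix_(i, j) dpart [:: i; j] u x.
Proof. by []. Qed.

Lemma hessian_sym x : (1 < m)%N -> fnorm x < 1 -> Defs.symmetric (hessian u x).
Proof.
move=> m1 x1; apply/matrixP => i j; rewrite !mxE.
exact: (@dpart_swap [::] j i x m1 x1).
Qed.

(** The continuous extension to the compact closed ball gives boundedness, without which [sup] and
    [inf] in [osc] would be default values. *)
Lemma bounded_on_ball : exists M, forall x, fnorm x < 1 -> `|u x| <= M.
Proof.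
have [g [cg gE]] := Hu.2 [::] (leq0n _).
have cB := @compact_fnorm_le R n 1 ler01.
have EB : ecball 0 1 = [set x : 'rV[R]_n | fnorm x <= 1].
  by apply/seteqP; split => x; rewrite /ecball /= subr0.
rewrite EB in cg.
have B0 : [set x : 'rV[R]_n | fnorm x <= 1] !=set0.
  by exists 0; rewrite /= -(scale0r 0) fnormZ normr0 mul0r.
have [c _ cmax] := compact_EVT_max B0 cB cg.
have [d _ dmin] := compact_EVT_min B0 cB cg.
exists (Num.max `|g c| `|g d|) => x x1.
have xB : x \in [set x : 'rV[R]_n | fnorm x <= 1] by rewrite inE /= ltW.
have xE : eball 0 1 x by exact/eball0P.
have := cmax x xB; have := dmin x xB; rewrite (gE x xE) /= => h1 h2.
rewrite le_max; have [ux|ux] := leP 0 (u x).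
  by rewrite (ger0_norm ux) (le_trans h2)// ler_norm.
apply/orP; right; rewrite (ltr0_norm ux).
have : - g d <= `|g d| by rewrite -normrN ler_norm.
lra.
Qed.

Lemma osc_bounds : exists2 c, forall x, fnorm x < 1 -> - osc u (eball 0 1) <= u x - c <= 0
  & 0 <= osc u (eball 0 1).
Proof.
have [M uM] := bounded_on_ball.
have b0 : eball 0 1 (0 : 'rV[R]_n).
  by apply/eball0P; rewrite -(scale0r 0) fnormZ normr0 mul0r ltr01.
have E0 : (u @` eball 0 1) (u 0) by exists 0.
have su : has_sup (u @` eball 0 1).
  split; first by exists (u 0).
  exists M => _ [x /eball0P x1 <-]; exact: le_trans (ler_norm _) (uM x x1).
have iu : has_inf (u @` eball 0 1).
  split; first by exists (u 0).
  exists (- M) => _ [x /eball0P x1 <-].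
  by have := uM x x1; rewrite ler_norml => /andP[].
have B x : fnorm x < 1 -> inf (u @` eball 0 1) <= u x <= sup (u @` eball 0 1).
  move=> x1; apply/andP; split.
    by apply: inf_lbound; [exact: iu.2|exists x => //; exact/eball0P].
  by apply: sup_ubound; [exact: su.2|exists x => //; exact/eball0P].
exists (sup (u @` eball 0 1)); last first.
  have /B/andP[h1 h2] : fnorm (0 : 'rV[R]_n) < 1 by exact/eball0P.
  by rewrite /osc subr_ge0 (le_trans h1).
move=> x /B; rewrite /osc; lra.
Qed.

End Partials.

(** * Linear combinations of expansions *)

Section LinearCombinations.
Variables (R : realType) (n : nat).
Implicit Types (x b xi e : 'rV[R]_n) (G N A : 'M[R]_n).

Lemma dot_sum e (b : 'I_n -> 'rV[R]_n) xi :
  dot (\sum_k e 0 k *: b k) xi = \sum_k e 0 k * dot (b k) xi.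
Proof.
elim: (index_enum _) => [|k r IH]; last by rewrite !big_cons dotDl dotZl IH.
by rewrite !big_nil /dot big1// => i _; rewrite mxE mul0r.
Qed.

Lemma frob_sum A e (G : 'I_n -> 'M[R]_n) :
  frob A (\sum_k e 0 k *: G k) = \sum_k e 0 k * frob A (G k).
Proof.
elim: (index_enum _) => [|k r IH]; last by rewrite !big_cons frobD frobZ IH.
by rewrite !big_nil -(scale0r 0) frobZ mul0r.
Qed.

Lemma quad_sum e (G : 'I_n -> 'M[R]_n) xi :
  quad (\sum_k e 0 k *: G k) xi = \sum_k e 0 k * quad (G k) xi.
Proof.
rewrite /quad frobC frob_sum; apply: eq_bigr => k _; congr (_ * _); exact: frobC.
Qed.

Lemma jet2_at_sum (f : 'I_n -> 'rV[R]_n -> R) x e (b : 'I_n -> 'rV[R]_n)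
    (G : 'I_n -> 'M[R]_n) : (forall k, jet2_at (f k) x (b k) (G k)) ->
  jet2_at (fun y => \sum_k e 0 k * f k y) x (\sum_k e 0 k *: b k) (\sum_k e 0 k *: G k).
Proof.
move=> H xi; rewrite dot_sum quad_sum mulr_suml.
apply: (@jet_sum R 2 n (fun k t => e 0 k * f k (x + t *: xi))) => k.
by rewrite -mulrA; apply: jetZ; exact: H.
Qed.

Lemma sqr_dot_le b e : dot b e ^+ 2 <= fnorm b ^+ 2 * fnorm e ^+ 2.
Proof. by rewrite !sqr_fnorm_row; exact: Cauchy_Schwarz_sum. Qed.

Lemma continuous_comb (f : 'I_n -> 'rV[R]_n -> R) x e :
  (forall k, {for x, continuous (f k)}) ->
  {for x, continuous (fun y => \sum_k e 0 k * f k y)}.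
Proof.
move=> H; apply: (@cvg_sumr _ _ (nbhs x) _ _ _ (fun k y => e 0 k * f k y)) => k.
by apply: cvgMr; exact: H.
Qed.

End LinearCombinations.

(** * The interior estimates for first and second derivatives *)

Section Estimates.
Variables (R : realType) (n m : nat) (lam Lam : R).
Variables (F : 'M[R]_n -> R) (u : 'rV[R]_n -> R).
Hypotheses (lam0 : 0 < lam) (Lam0 : 0 < Lam).
Hypotheses (qF : quasiconcave F) (eF : uniformly_elliptic F lam Lam) (cF : C1_sym F).
Hypotheses (F0 : F 0 = 0) (Hu : Ck_cball m 0 1 u) (m2 : (2 < m)%N).
Hypothesis Fu : forall x, eball 0 1 x -> F (hessian u x) = 0.
Implicit Types (x e : 'rV[R]_n) (A : 'M[R]_n).

Arguments dpart : simpl never.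

(** These stand for [u_e] and [u_ee]. As explicit combinations of partial derivatives they inherit
    expansions from [dpart_jet2] by linearity. *)
Definition first_dir e x : R := \sum_k e 0 k * dpart [:: k] u x.
Definition second_dir e x : R := \sum_k e 0 k * \sum_l e 0 l * dpart [:: k; l] u x.

Definition first_dir_grad e x : 'rV[R]_n :=
  \sum_k e 0 k *: (\row_i dpart [:: i; k] u x).
Definition first_dir_hess e x : 'M[R]_n :=
  \sum_k e 0 k *: (\matrix_(i, j) dpart [:: i; j; k] u x).
Definition second_dir_grad e x : 'rV[R]_n :=
  \sum_k e 0 k *: \sum_l e 0 l *: (\row_i dpart [:: i; k; l] u x).
Definition second_dir_hess e x : 'M[R]_n :=
  \sum_k e 0 k *: \sum_l e 0 l *: (\matrix_(i, j) dpart [:: i; j; k; l] u x).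

Lemma first_dir_jet e x : fnorm x < 1 ->
  jet2_at (first_dir e) x (first_dir_grad e x) (first_dir_hess e x).
Proof. by move=> x1; apply: jet2_at_sum => k; exact: (dpart_jet2 Hu). Qed.

Lemma second_dir_jet e x : (3 < m)%N -> fnorm x < 1 ->
  jet2_at (second_dir e) x (second_dir_grad e x) (second_dir_hess e x).
Proof.
move=> m3 x1; apply: jet2_at_sum => k.
by apply: (@jet2_at_sum R n (fun l => dpart [:: k; l] u)) => l; exact: (dpart_jet2 Hu).
Qed.

Lemma sym_matrix_dpart s x : ((size s).+1 < m)%N -> fnorm x < 1 ->
  Defs.symmetric (\matrix_(i, j) dpart [:: i, j & s] u x).
Proof.
move=> sm x1; apply/matrixP => i j; rewrite !mxE.
exact: (dpart_swap Hu).
Qed.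

Lemma first_dir_hess_sym e x : fnorm x < 1 -> Defs.symmetric (first_dir_hess e x).
Proof. by move=> x1; apply: sym_sum => k; apply: symZ; exact: (@sym_matrix_dpart [:: k]). Qed.

Lemma second_dir_hess_sym e x : (3 < m)%N -> fnorm x < 1 ->
  Defs.symmetric (second_dir_hess e x).
Proof.
move=> m3 x1; apply: sym_sum => k; apply: symZ; apply: sym_sum => l; apply: symZ.
exact: (@sym_matrix_dpart [:: k; l]).
Qed.

(** Shows [u_ee] as a component of the gradient of [u_e], the domination that [bernstein_data] asks
    for. *)
Lemma second_dir_dot e x : second_dir e x = dot (first_dir_grad e x) e.
Proof.
rewrite dot_sum /second_dir; under eq_bigr do rewrite mulr_sumr.
rewrite exchange_big /=; apply: eq_bigr => l _; rewrite mulr_sumr.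
by apply: eq_bigr => k _; rewrite mxE; ring.
Qed.

Lemma linearized_facts x : fnorm x < 1 -> exists A, [/\ elliptic_form lam Lam A,
  frob A (hessian u x) <= 0,
  forall e, frob A (first_dir_hess e x) = 0 &
  forall e, (3 < m)%N -> 0 <= frob A (second_dir_hess e x)].
Proof.
move=> x1.
have sM y : fnorm y < 1 -> Defs.symmetric (hessian u y).
  by move=> y1; apply: (hessian_sym Hu) => //; exact: ltnW.
have FM y : fnorm y < 1 -> F (hessian u y) = 0 by move=> y1; apply: Fu; exact/eball0P.
have [A eA supA] := linearization (ltW lam0) (ltW Lam0) cF qF eF (sM x x1).
(* Only the Hessian moves along the line; [A] stays at its value for [x], so no derivative of the
   coefficients appears. *)
pose phi e t := \sum_i \sum_j A i j * dpart [:: i; j] u (x + t *: e).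
have phiE e t : phi e t = frob A (hessian u (x + t *: e)).
  by apply: eq_bigr => i _; apply: eq_bigr => j _; rewrite mxE.
have phi0 e : phi e 0 = \sum_i \sum_j A i j * dpart [:: i; j] u x.
  by rewrite /phi scale0r addr0.
have phimin e : \forall t \near (0 : R), \sum_i \sum_j A i j * dpart [:: i; j] u x <= phi e t.
  have := near_line e (near_unit_ball x1); apply: filterS => t xt.
  rewrite -(phi0 e) !phiE scale0r addr0 -subr_ge0 -frobN -frobD.
  by apply: supA; [exact: sM|rewrite !FM].
exists A; split => //.
- have := supA 0 (@sym0 R n); rewrite FM// F0 => /(_ (lexx _)).
  by rewrite sub0r frobN oppr_ge0.
- move=> e.
  have jphi : jet 1 (phi e) (\sum_i \sum_j A i j * dpart [:: i; j] u x)
      (\sum_i \sum_j A i j * \sum_k e 0 k * dpart [:: k; i; j] u x)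
      (\sum_(i < n) \sum_(j < n) A i j * 0).
    apply: (@jet_sum R 1 n (fun i t => \sum_j A i j * dpart [:: i; j] u (x + t *: e))) => i.
    apply: (@jet_sum R 1 n (fun j t => A i j * dpart [:: i; j] u (x + t *: e))) => j.
    by apply: jetZ; exact: (dpart_jet1 Hu).
  rewrite -[RHS](jet1_min_eq0 jphi (phimin e)) frob_sum /frob.
  under eq_bigr do rewrite mulr_sumr; rewrite exchange_big /=; apply: eq_bigr => i _.
  under eq_bigr do rewrite mulr_sumr; rewrite exchange_big /=; apply: eq_bigr => j _.
  rewrite mulr_sumr; apply: eq_bigr => k _.
  by rewrite mxE (dpart_rot Hu (s := [::]) i j k)//; ring.
- move=> e m3.
  have jphi : jet 2 (phi e) (\sum_i \sum_j A i j * dpart [:: i; j] u x)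
      (\sum_i \sum_j A i j * dot (\row_k dpart [:: k; i; j] u x) e)
      (\sum_i \sum_j A i j * (quad (\matrix_(k, l) dpart [:: k; l; i; j] u x) e / 2)).
    apply: (@jet_sum R 2 n (fun i t => \sum_j A i j * dpart [:: i; j] u (x + t *: e))) => i.
    apply: (@jet_sum R 2 n (fun j t => A i j * dpart [:: i; j] u (x + t *: e))) => j.
    by apply: jetZ; exact: (dpart_jet2 Hu).
  have := jet2_min_ge0 jphi (phimin e).
  suff -> : \sum_i \sum_j A i j * (quad (\matrix_(k, l) dpart [:: k; l; i; j] u x) e / 2)
     = frob A (second_dir_hess e x) / 2 by rewrite pmulr_lge0// invr_gt0.
  rewrite frob_sum.
  under [in RHS]eq_bigr do rewrite frob_sum.
  transitivity (\sum_k \sum_l \sum_i \sum_j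
     A i j * (dpart [:: k; l; i; j] u x * (e 0 k * e 0 l)) / 2).
    rewrite [RHS](eq_bigr (fun k => \sum_i \sum_l \sum_j
     A i j * (dpart [:: k; l; i; j] u x * (e 0 k * e 0 l)) / 2)); last first.
      by move=> k _; rewrite exchange_big.
    rewrite [RHS]exchange_big /=; apply: eq_bigr => i _.
    rewrite [RHS](eq_bigr (fun k => \sum_j \sum_l
     A i j * (dpart [:: k; l; i; j] u x * (e 0 k * e 0 l)) / 2)); last first.
      by move=> k _; rewrite exchange_big.
    rewrite [RHS]exchange_big /=; apply: eq_bigr => j _.
    rewrite quadE mulr_suml mulr_sumr; apply: eq_bigr => k _.
    rewrite mulr_suml mulr_sumr; apply: eq_bigr => l _; rewrite mxE; ring.
  rewrite mulr_suml; apply: eq_bigr => k _.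
  rewrite mulr_sumr mulr_suml; apply: eq_bigr => l _.
  rewrite /frob !mulr_sumr mulr_suml; apply: eq_bigr => i _.
  rewrite !mulr_sumr mulr_suml; apply: eq_bigr => j _.
  by rewrite mxE (dpart_rot2 Hu i j k l)//; ring.
Qed.

Let S : R := Num.sqrt (15 * Lam / lam).
Let om : R := osc u (eball 0 1).

Lemma lt_unit (r : R) x : r < 1 -> fnorm x <= r -> fnorm x < 1.
Proof. by move=> r1 xr; exact: le_lt_trans xr r1. Qed.

Lemma first_dir_continuous e x : fnorm x < 1 -> {for x, continuous (first_dir e)}.
Proof.
move=> x1; apply: continuous_comb => k.
by apply: (dpart_continuous Hu) => //=; exact: ltnW (ltnW m2).
Qed.

Lemma second_dir_continuous e x : fnorm x < 1 -> {for x, continuous (second_dir e)}.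
Proof.
move=> x1; apply: continuous_comb => k; apply: continuous_comb => l.
by apply: (dpart_continuous Hu) => //=; exact: ltnW.
Qed.

Lemma first_dir_weighted e x : fnorm e = 1 -> fnorm x <= 7 / 8 ->
  ((7 / 8) ^+ 2 - fnorm x ^+ 2) * first_dir e x <= S * om.
Proof.
(* The radii decrease from 7/8 through 3/4 to 1/2: the compact balls of the maximum principle lie
   inside the open unit ball, and the gradient bound holds on the ball where the second-derivative
   estimate uses it. *)
move=> e1; have r1 : 7 / 8 < 1 :> R by lra.
have [c uc om0] := osc_bounds Hu.
have rr : 0 <= (7 / 8 : R) <= 1 by lra.
apply: (bernstein (v := fun y => u y - c) lam0 Lam0 rr om0).
- by move=> y yr; apply: first_dir_continuous; exact: lt_unit yr.
- move=> y yr; apply: (@continuousB _ _ _ u (cst c)); last exact: cst_continuous.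
  by apply: (@dpart_continuous _ _ _ _ Hu [::]) => //; exact: lt_unit yr.
- move=> y yr; have := uc y (lt_unit r1 yr) => /andP[h1 h2].
  by rewrite ler_norml h1 (le_trans h2).
move=> y /ltW/(lt_unit r1) y1 _.
have [A [eA h1 h2 _]] := linearized_facts y1.
exists A, (first_dir_grad e y), (first_dir_hess e y), (\row_i dpart [:: i] u y), (hessian u y).
split; split => //.
- exact: first_dir_hess_sym.
- by apply: (hessian_sym Hu) => //; exact: ltnW.
- exact: first_dir_jet.
- move=> xi; have := jetD (dpart_jet2 Hu (s := [::]) (ltnW m2) y1 xi) (jet_cst 2 (- c)).
  by rewrite !addr0; exact.
- by rewrite h2.
- by rewrite mulr_le0//; have /andP[] := uc y y1.
have -> : first_dir e y = dot (\row_i dpart [:: i] u y) e.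
  by apply: eq_bigr => i _; rewrite mxE mulrC.
by have := sqr_dot_le (\row_i dpart [:: i] u y) e; rewrite e1 expr1n mulr1.
Qed.

(** Removes a cutoff [eta] bounded below by [d]. The bounds are one-sided, so [a] may be negative,
    where [d <= eta] gives nothing and [0 <= b] is used instead. *)
Lemma mul_le_cancel (d eta a b : R) :
  0 < d -> d <= eta -> 0 <= b -> eta * a <= b -> a <= b / d.
Proof.
move=> d0 de b0 ab; rewrite ler_pdivlMr//.
have [a0|a0] := leP a 0; first by apply: le_trans b0; nra.
by apply: le_trans ab; rewrite mulrC ler_pM2r.
Qed.

Lemma S_ge0 : 0 <= S. Proof. exact: sqrtr_ge0. Qed.

Lemma om_ge0 : 0 <= om. Proof. by have [] := osc_bounds Hu. Qed.

(** The cutoff is at least [(7/8)^2 - (3/4)^2 = 13/64] here. *)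
Lemma first_dir_bound e x : fnorm e = 1 -> fnorm x <= 3 / 4 ->
  first_dir e x <= S * om / (13 / 64).
Proof.
move=> e1 x34; apply: (mul_le_cancel (eta := (7 / 8) ^+ 2 - fnorm x ^+ 2)).
- by lra.
- have : fnorm x ^+ 2 <= (3 / 4) ^+ 2 by rewrite -fnorm_le//; lra.
  by rewrite !expr2; lra.
- by rewrite mulr_ge0 ?S_ge0 ?om_ge0.
by apply: first_dir_weighted => //; apply: le_trans x34 _; lra.
Qed.

Lemma first_dirZ a e x : first_dir (a *: e) x = a * first_dir e x.
Proof. by rewrite /first_dir mulr_sumr; apply: eq_bigr => k _; rewrite mxE mulrA. Qed.

(** [u_e] becomes the function [v] of the next estimate, which needs its absolute value; the
    direction [- e] supplies the lower bound. *)
Lemma norm_first_dir_bound e x : fnorm e = 1 -> fnorm x <= 3 / 4 ->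
  `|first_dir e x| <= S * om / (13 / 64).
Proof.
move=> e1 x34; rewrite ler_norml first_dir_bound// andbT lerNl -mulN1r -first_dirZ.
by apply: first_dir_bound => //; rewrite fnormZ normrN1 mul1r.
Qed.

(** Necessarily one-sided by this method: [u_ee] is even in [e], so a change of sign of [e] gives no
    lower bound. *)
Lemma second_dir_bound e x : (3 < m)%N -> fnorm e = 1 -> fnorm x <= 1 / 2 ->
  second_dir e x <= S * (S * om / (13 / 64)) / (5 / 16).
Proof.
move=> m3 e1 x12.
have K0 : 0 <= S * om / (13 / 64) by rewrite divr_ge0 ?mulr_ge0 ?S_ge0 ?om_ge0//; lra.
(* The lower bound of the cutoff is [(3/4)^2 - (1/2)^2 = 5/16]. *)
apply: (mul_le_cancel (eta := (3 / 4) ^+ 2 - fnorm x ^+ 2)).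
- by lra.
- have : fnorm x ^+ 2 <= (1 / 2) ^+ 2 by rewrite -fnorm_le//; lra.
  by rewrite !expr2; lra.
- by rewrite mulr_ge0 ?S_ge0.
have r1 : 3 / 4 < 1 :> R by lra.
have rr : 0 <= (3 / 4 : R) <= 1 by lra.
apply: (bernstein (v := first_dir e) lam0 Lam0 rr K0).
- by move=> y yr; apply: second_dir_continuous; exact: lt_unit yr.
- by move=> y yr; apply: first_dir_continuous; exact: lt_unit yr.
- by move=> y yr; exact: norm_first_dir_bound.
- move=> y /ltW/(lt_unit r1) y1 _.
  have [A [eA _ h2 h3]] := linearized_facts y1.
  exists A, (second_dir_grad e y), (second_dir_hess e y),
    (first_dir_grad e y), (first_dir_hess e y).
  split; split => //.
  + exact: second_dir_hess_sym.
  + exact: first_dir_hess_sym.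
  + exact: second_dir_jet.
  + exact: first_dir_jet.
  + exact: h3.
  + by rewrite h2 mulr0.
  rewrite second_dir_dot.
  by have := sqr_dot_le (first_dir_grad e y) e; rewrite e1 expr1n mulr1.
by apply: le_trans x12 _; lra.
Qed.

Lemma unit_vector e : fnorm e != 0 -> fnorm ((fnorm e)^-1 *: e) = 1.
Proof. by move=> e0; rewrite fnormZ ger0_norm ?invr_ge0 ?fnorm_ge0// mulVf. Qed.

Lemma grad_bound x : fnorm x <= 3 / 4 -> fnorm (grad u x) <= S * om / (13 / 64).
Proof.
move=> x34; have [->|g0] := eqVneq (fnorm (grad u x)) 0.
  by rewrite divr_ge0 ?mulr_ge0 ?S_ge0 ?om_ge0//; lra.
(* In the direction of the gradient itself, the derivative of [u] is the norm of the gradient. *)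
have := first_dir_bound (unit_vector g0) x34.
rewrite first_dirZ (_ : first_dir _ _ = fnorm (grad u x) ^+ 2).
  by rewrite expr2 mulKf.
by rewrite sqr_fnorm_row; apply: eq_bigr => k _; rewrite mxE expr2.
Qed.

Lemma hessian_bound x : (3 < m)%N -> fnorm x <= 1 / 2 ->
  opnorm (hessian u x) <= 2 * (1 + Lam / lam) * (S * (S * om / (13 / 64)) / (5 / 16)).
Proof.
move=> m3 x12; have x1 : fnorm x < 1 by apply: lt_unit x12; lra.
have K0 : 0 <= S * om / (13 / 64) by rewrite divr_ge0 ?mulr_ge0 ?S_ge0 ?om_ge0//; lra.
apply: (opnorm_le_of_upper lam0 (ltW Lam0) _ eF F0).
- by apply: divr_ge0; [exact: mulr_ge0 S_ge0 K0|lra].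
- by apply: Fu; exact/eball0P.
- by apply: (hessian_sym Hu) => //; exact: ltnW.
move=> z; rewrite quad_col -(fnorm_tr z); set xi := z^T.
have [xi0|xi0] := eqVneq (fnorm xi) 0.
  have q0 : quad (hessian u x) xi = 0.
    by rewrite (fnorm_eq0 xi0) /quad mulmx0 -(scale0r 0) frobZ mul0r.
  by rewrite q0 xi0 expr0n mulr0.
have -> : quad (hessian u x) xi = fnorm xi ^+ 2 * second_dir ((fnorm xi)^-1 *: xi) x.
  rewrite quadE /second_dir mulr_sumr; apply: eq_bigr => i _.
  rewrite !mulr_sumr; apply: eq_bigr => j _.
  rewrite hessianE !mxE; set D := dpart _ _ _; set a := xi 0 i; set b := xi 0 j.
  by field.
rewrite mulrC; apply: ler_wpM2r; first exact: sqr_ge0.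
exact: second_dir_bound (unit_vector xi0) x12.
Qed.

End Estimates.

Theorem theorem3p5 (R : realType) (n : nat) (lam Lam : R) :
  0 < lam -> lam <= Lam ->
  exists C : R,
    (forall (F : 'M[R]_n -> R) (u : 'rV[R]_n -> R),
       quasiconcave F -> uniformly_elliptic F lam Lam -> C1_sym F -> F 0 = 0 ->
       Ck_cball 3 0 1 u ->
       (forall x, eball 0 1 x -> F (hessian u x) = 0) ->
       forall x, eball 0 (1 / 2) x -> fnorm (grad u x) <= C * osc u (eball 0 1)) /\
    (forall (F : 'M[R]_n -> R) (u : 'rV[R]_n -> R),
       quasiconcave F -> uniformly_elliptic F lam Lam -> C1_sym F -> C2_sym F ->
       F 0 = 0 ->
       Ck_cball 3 0 1 u -> Ck_cball 4 0 1 u ->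
       (forall x, eball 0 1 x -> F (hessian u x) = 0) ->
       forall x, eball 0 (1 / 2) x -> opnorm (hessian u x) <= C * osc u (eball 0 1)).
Proof.
move=> lam0 lamLam; have Lam0 : 0 < Lam := lt_le_trans lam0 lamLam.
pose S := Num.sqrt (15 * Lam / lam).
have S0 : 0 <= S by exact: sqrtr_ge0.
pose C1 := S / (13 / 64).
pose C2 := 2 * (1 + Lam / lam) * (S * C1 / (5 / 16)).
have C10 : 0 <= C1 by rewrite divr_ge0//; lra.
have C20 : 0 <= C2.
  by rewrite !mulr_ge0// ?addr_ge0// ?invr_ge0 ?divr_ge0 ?(ltW lam0) ?(ltW Lam0)//; lra.
(* One constant has to serve both estimates; the sum does, because both constants and the
   oscillation are nonnegative. *)
exists (C1 + C2); split.
  move=> F u qF eF cF F0 Hu Fu x /eball0P xr.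
  have x34 : fnorm x <= 3 / 4 by lra.
  apply: le_trans (grad_bound lam0 Lam0 qF eF cF F0 Hu isT Fu x34) _.
  have := om_ge0 Hu; set om := osc _ _ => om0; rewrite -/S.
  have -> : S * om / (13 / 64) = C1 * om by rewrite /C1 mulrAC.
  by rewrite mulrDl lerDl mulr_ge0.
move=> F u qF eF cF _ F0 _ Hu Fu x /eball0P xr.
apply: le_trans (hessian_bound lam0 Lam0 qF eF cF F0 Hu isT Fu isT (ltW xr)) _.
have := om_ge0 Hu; set om := osc _ _ => om0; rewrite -/S.
have -> : S * om / (13 / 64) = C1 * om by rewrite /C1 mulrAC.
have -> : 2 * (1 + Lam / lam) * (S * (C1 * om) / (5 / 16)) = C2 * om by rewrite /C2; ring.
by rewrite mulrDl lerDr mulr_ge0.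
Qed.
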